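(* Let $S$ be a bilateral weighted shift on a complex Hilbert space $\mathcal{H}$ with orthonormal basis $(e_n)_{n\in\mathbb{Z}}$ and bounded weight sequence $(\omega_n)_{n\in\mathbb{Z}}$ of positive real numbers, i.e. $Se_n=\omega_n e_{n+1}$ for all $n\in\mathbb{Z}$. If $S$ possesses Bishop's property $(\beta)$, then $$q(S)=r_1^-(S)=r_2^-(S)=r_3^-(S)=r^-(S)$$ and $$r_1^+(S)=r_2^+(S)=r_3^+(S)=r^+(S)=r(S).$$
   Context: $r(S)$ is the spectral radius and $q(S)=\min\{|\lambda|:\lambda\in\sigma(S)\}$. Put $\beta_n=\omega_0\cdots\omega_{n-1}$ for $n>0$, $\beta_0=1$, and $\beta_n=\frac{1}{\omega_n\cdots\omega_{-1}}$ for $n<0$. Define $r^-(S)=\lim_{n\to+\infty}\big[\sup_{k>0}\frac{\beta_{-k}}{\beta_{-n-k}}\big]^{1/n}$, $r^+(S)=\lim_{n\to+\infty}\big[\sup_{k\ge0}\frac{\beta_{n+k}}{\beta_k}\big]^{1/n}$, $r_1^-(S)=\lim_{n\to+\infty}\big[\inf_{k>0}\frac{\beta_{-k}}{\beta_{-n-k}}\big]^{1/n}$, $r_1^+(S)=\lim_{n\to+\infty}\big[\inf_{k\ge0}\frac{\beta_{n+k}}{\beta_k}\big]^{1/n}$, $r_2^-(S)=\liminf_{n\to+\infty}[1/\beta_{-n}]^{1/n}$, $r_2^+(S)=\liminf_{n\to+\infty}\beta_n^{1/n}$, $r_3^-(S)=\limsup_{n\to+\infty}[1/\beta_{-n}]^{1/n}$,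 $r_3^+(S)=\limsup_{n\to+\infty}\beta_n^{1/n}$. For open $U\subset\mathbb{C}$, $\mathcal{O}(U,\mathcal{H})$ is the Fréchet space of analytic $\mathcal{H}$-valued functions on $U$ with the topology of uniform convergence on compact subsets. A bounded operator $T$ on $\mathcal{H}$ possesses Bishop's property $(\beta)$ if for every open $U\subset\mathbb{C}$ the map $T_U$ on $\mathcal{O}(U,\mathcal{H})$, $T_Uf(\lambda)=(T-\lambda)f(\lambda)$, is injective with closed range; equivalently, for every open $U$ and every sequence $(f_n)$ in $\mathcal{O}(U,\mathcal{H})$, $T_Uf_n\to0$ implies $f_n\to0$ in $\mathcal{O}(U,\mathcal{H})$. *)

(* Defs.v *)
From HB Require Import structures.
From mathcomp Require Import all_boot all_order all_algebra.
From mathcomp Require Import sesquilinear complex.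
From mathcomp Require Import all_classical all_reals all_analysis.

Set Implicit Arguments.
Unset Strict Implicit.
Unset Printing Implicit Defensive.

Import Order.TTheory GRing.Theory Num.Theory Num.Def numFieldNormedType.Exports.

Local Open Scope classical_set_scope.
Local Open Scope ring_scope.
Local Open Scope complex_scope.

Section Operators.
Variables (R : realType) (H : completeNormedModType R[i]).

(* A complete normed module whose norm satisfies this is a Hilbert space; the
   form [dot] is linear on the left and conjugate-linear on the right. *)
Definition norm_from_dot (dot : {dot H for conjC}) : Prop :=
  forall x : H, `|x| ^+ 2 = dot x x.

(* The second clause says that the linear span of the family is dense. *)
Definition orthonormal_basis (dot : {dot H for conjC}) (e : int -> H) : Prop :=
  (forall m n : int, dot (e m) (e n) = (m == n)%:R) /\
  closure [set x : H | exists (s : seq int) (c : int -> R[i]),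
                         x = \sum_(n <- s) c n *: e n] = [set: H].

(* For a linear map, boundedness of the operator is continuity. *)
Definition bilateral_weighted_shift
    (S : {linear H -> H}) (e : int -> H) (w : int -> R) : Prop :=
  [/\ forall n, 0 < w n,
      exists M : R, forall n, w n <= M,
      continuous S &
      forall n, S (e n) = (w n)%:C *: e (n + 1)].

(* The points z at which S - z has no inverse in the algebra of bounded
   operators. *)
Definition spectrum (S : {linear H -> H}) : set R[i] :=
  [set z | ~ exists T : {linear H -> H},
      [/\ continuous T,
          forall x, T (S x - z *: x) = x &
          forall x, S (T x) - z *: T x = x]].

(* The spectrum of a bounded operator on a nonzero complex Hilbert space is
   nonempty and compact, so this supremum and infimum are a maximum and a
   minimum. *)
Definition spectral_radius (S : {linear H -> H}) : R :=
  sup [set ComplexField.Normc.normc z | z in spectrum S].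

Definition min_modulus (S : {linear H -> H}) : R :=
  inf [set ComplexField.Normc.normc z | z in spectrum S].

(* For U open, the elements of O(U, H) are represented by functions on the
   whole plane satisfying this; their values outside U are irrelevant.
   Since the scalar field is R[i], [derivable] is complex
   differentiability. *)
Definition analytic_on (U : set R[i]^o) (f : R[i]^o -> H) : Prop :=
  forall z, U z -> derivable f z 1.

Definition bishop_op (S : {linear H -> H}) (f : R[i]^o -> H) : R[i]^o -> H :=
  fun z => S (f z) - z *: f z.

Definition bishop_injective (S : {linear H -> H}) (U : set R[i]^o) : Prop :=
  forall f g, analytic_on U f -> analytic_on U g ->
    (forall z, U z -> bishop_op S f z = bishop_op S g z) ->
    forall z, U z -> f z = g z.

Definition bishop_range (S : {linear H -> H}) (U : set R[i]^o) :
    set (R[i]^o -> H) :=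
  [set g | exists f, analytic_on U f /\
                     forall z, U z -> g z = bishop_op S f z].

Definition compact_convergence (U : set R[i]^o) :=
  {family [set K : set R[i]^o | compact K /\ K `<=` U], R[i]^o -> H}.

(* The range is closed relative to O(U, H). The topology of
   [compact_convergence U] only sees values on U, and [bishop_range S U] only
   depends on values on U, so no quotient by equality on U is needed. *)
Definition bishop_closed_range (S : {linear H -> H}) (U : set R[i]^o) : Prop :=
  forall g, analytic_on U g ->
    closure (bishop_range S U : set (compact_convergence U)) g ->
    bishop_range S U g.

Definition bishop_property_beta (S : {linear H -> H}) : Prop :=
  forall U : set R[i]^o, open U ->
    bishop_injective S U /\ bishop_closed_range S U.

End Operators.

Section Weights.
Variables (R : realType) (w : int -> R).

(* [Negz m] is -(m + 1), and the weights involved are w(-1), ..., w(-m-1). *)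
Definition beta (n : int) : R :=
  match n with
  | Posz m => \prod_(k < m) w k%:Z
  | Negz m => (\prod_(k < m.+1) w (- (k.+1)%:Z))^-1
  end.

Definition r_minus : R :=
  limn (fun n : nat =>
    sup [set beta (- k%:Z) / beta (- n%:Z - k%:Z)
        | k in [set k : nat | (0 < k)%N]] `^ n%:R^-1).

Definition r_plus : R :=
  limn (fun n : nat =>
    sup [set beta (n%:Z + k%:Z) / beta k%:Z | k in [set: nat]] `^ n%:R^-1).

Definition r1_minus : R :=
  limn (fun n : nat =>
    inf [set beta (- k%:Z) / beta (- n%:Z - k%:Z)
        | k in [set k : nat | (0 < k)%N]] `^ n%:R^-1).

Definition r1_plus : R :=
  limn (fun n : nat =>
    inf [set beta (n%:Z + k%:Z) / beta k%:Z | k in [set: nat]] `^ n%:R^-1).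

Definition r2_minus : R :=
  limn_inf (fun n : nat => (1 / beta (- n%:Z)) `^ n%:R^-1).

Definition r2_plus : R :=
  limn_inf (fun n : nat => beta n%:Z `^ n%:R^-1).

Definition r3_minus : R :=
  limn_sup (fun n : nat => (1 / beta (- n%:Z)) `^ n%:R^-1).

Definition r3_plus : R :=
  limn_sup (fun n : nat => beta n%:Z `^ n%:R^-1).

End Weights.

(* Main.v *)
Require Import Defs.
From HB Require Import structures.
From mathcomp Require Import all_boot all_order all_algebra.
From mathcomp Require Import sesquilinear complex.
From mathcomp Require Import all_classical all_reals all_analysis.
From mathcomp Require Import ring lra zify.

Set Implicit Arguments.
Unset Strict Implicit.
Unset Printing Implicit Defensive.

Import Order.TTheory GRing.Theory Num.Theory Num.Def numFieldNormedType.Exports.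

Local Open Scope classical_set_scope.
Local Open Scope ring_scope.
Local Open Scope complex_scope.

(** Write beta n for the weights and u_n(z) = beta_n z^(-n) for the coordinates of
    the formal eigenvector of S at z: it satisfies (S - z) u = 0 coordinatewise, so
    for a truncation of u to a window [K, N) only the two end coordinates survive
    in (S - z) u.  Everything rests on this remark.

    Suppose that on some annulus lo < |z| < hi there are windows [K, N) with an
    interior point P at which |u| is much larger than at both ends (a peak).  The
    truncations F, normalised to have coordinate 1 at P, do not tend to 0 although
    (S - z) F does, uniformly on the annulus.  If such windows go off to infinity,
    then g = sum of the (S - z) F_m is an analytic limit of elements of the range of
    S - z, so by closed range g = (S - z) f with f analytic.  The difference between
    f(z) and the formal sum of the F_m(z) is annihilated by S - z, hence is a
    multiple h(z) u(z); since the coordinates of f(z) tend to 0,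
    |h(z)| |u_{P_m}(z)| tends to 1.  This cannot happen at two radii, because the
    ratio of |u_{P_m}| at radii c < c' is (c'/c)^{P_m} ([no_peak_family]).

    A long window along which beta grows faster than b^n, followed further to the
    right by a long window along which it grows slower than a^n with a < b, produces
    such a peak ([peak_of_windows]).  So, on each half of Z separately, for a < b
    either all windows have growth at most C b^n or all have growth at least C a^n
    ([growth_right_dichotomy], [growth_left_dichotomy]).  Consequently each half-line
    has a single growth rate, rl on the left and rr on the right, which controls all
    windows uniformly ([growth_threshold]) and is the common value of the four
    quantities r_1, r_2, r_3, r attached to that half-line.  Moreover rl <= rr:
    otherwise the formal eigenvector is a genuine one, analytic in z on the annulus
    rr < |z| < rl, against the injectivity part of property (beta)
    ([growth_left_le_right]).

    It remains to identify the extreme moduli of the spectrum.  The uniform estimates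
    on windows give norm estimates for the powers of S, from which S - z is invertible
    for |z| > rr and for |z| < rl.  Conversely rr and rl themselves lie in the
    spectrum.  If S - r is bounded below, applying it to truncations of u shows that
    the sum of |u_j(r)|^2 over any window is at most a constant times its two end
    terms, which forces |u_j(r)|^2 to grow or to decay exponentially
    ([endpoint_dichotomy]); at r = rr (on the right) and r = rl (on the left) the
    growth is subexponential. *)

Local Notation normc := ComplexField.Normc.normc.

(** * Uniform growth rates of positive sequences *)
Section Growth.
Variable R : realType.
Implicit Types (x d : nat -> R) (a b r t C : R).

(** The constant is uniform in the position of the window [i, i+n): this is what
    distinguishes growth rates of windows from those of the sequence itself. *)
Definition upper_growth d b :=
  exists2 C, 0 < C & forall i n, d (i + n)%N <= C * b ^+ n * d i.

Definition lower_growth d a :=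
  exists2 C, 0 < C & forall i n, C * a ^+ n * d i <= d (i + n)%N.

Lemma expr_unbounded t C : 1 < t ->
  exists n0, forall n, (n0 <= n)%N -> C <= t ^+ n.
Proof.
move=> t1.
have bern n : n%:R * (t - 1) <= t ^+ n.
  elim: n => [|n IH]; first by rewrite mul0r expr0.
  have t1n : 1 <= t ^+ n by apply: exprn_ege1; lra.
  rewrite exprS -natr1; nra.
exists (Num.truncn (C / (t - 1))).+1 => n le_n.
apply: le_trans (bern n).
rewrite -ler_pdivrMr ?subr_gt0//; apply: le_trans (ltW (truncnS_gt _)) _.
by rewrite ler_nat.
Qed.

Lemma geometric_dominates a b C : 0 < a -> a < b ->
  exists n0, forall n, (n0 <= n)%N -> C * a ^+ n <= b ^+ n.
Proof.
move=> a0 ab; have [|n0 Hn0] := @expr_unbounded (b / a) C.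
  by rewrite ltr_pdivlMr// mul1r.
exists n0 => n /Hn0; rewrite expr_div_n ler_pdivlMr ?exprn_gt0//.
Qed.

Lemma geometric_small t C (delta : R) : 0 < t -> t < 1 -> 0 < delta ->
  exists n0, forall n, (n0 <= n)%N -> C * t ^+ n <= delta.
Proof.
move=> t0 t1 delta0; have [n0 Hn0] := geometric_dominates (C / delta) t0 t1.
exists n0 => n /Hn0; rewrite expr1n mulrAC ler_pdivrMr// mul1r//.
Qed.

Lemma root_exprK t n : 0 <= t -> (0 < n)%N -> (t ^+ n) `^ n%:R^-1 = t.
Proof.
move=> t0 n0; rewrite -powR_mulrn// -powRrM mulfV ?powRr1//.
by rewrite pnatr_eq0 -lt0n.
Qed.

(** Two-sided geometric bounds with unspecified constants determine the limit of
    n-th roots; each of the four quantities attached to a half-line is obtained from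
    this lemma. *)
Lemma root_cvg x r : 0 <= r -> (forall n, 0 <= x n) ->
  (forall b, r < b -> exists C, forall n, x n <= C * b ^+ n) ->
  (forall a, 0 < a < r -> exists2 C, 0 < C & forall n, C * a ^+ n <= x n) ->
  x n `^ n%:R^-1 @[n --> \oo] --> r.
Proof.
move=> r0 x0 ub lb; apply/cvgrPdist_le => /= e e0.
have [n1 Hn1] : exists n1, forall n, (n1 <= n)%N -> x n `^ n%:R^-1 <= r + e.
  have [|C HC] := ub (r + e / 2); first lra.
  have [||n0 Hn0] := @geometric_dominates (r + e / 2) (r + e) C; [lra|lra|].
  exists n0.+1 => -[//|n] nn0.
  rewrite -[leRHS](@root_exprK _ n.+1)//; last lra.
  apply: ge0_ler_powR; rewrite ?nnegrE ?invr_ge0 ?exprn_ge0//; first lra.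
  by apply: le_trans (HC _) (Hn0 _ _); apply: ltnW.
have [n2 Hn2] : exists n2, forall n, (n2 <= n)%N -> r - e <= x n `^ n%:R^-1.
  have [re0|re0] := lerP (r - e) 0.
    by exists 0%N => n _; rewrite (le_trans re0)// powR_ge0.
  have [|C C0 HC] := lb (r - e / 2); first by apply/andP; split; lra.
  have [||n0 Hn0] := @geometric_dominates (r - e) (r - e / 2) C^-1; [lra|lra|].
  exists n0.+1 => -[//|n] nn0.
  rewrite -[leLHS](@root_exprK _ n.+1)//; last lra.
  apply: ge0_ler_powR; rewrite ?nnegrE ?invr_ge0 ?exprn_ge0//; first lra.
  apply: le_trans (HC _).
  by rewrite -ler_pdivrMl//; apply: Hn0; apply: ltnW.
exists (maxn n1 n2) => // n /=; rewrite geq_max => /andP[/Hn1 h1 /Hn2 h2].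
by rewrite ler_distl; apply/andP; split; lra.
Qed.

Section Rates.
Variables (d : nat -> R) (r : R).
Hypotheses (d0 : forall n, 0 < d n) (r0 : 0 <= r)
  (ubd : forall b, r < b -> upper_growth d b)
  (lbd : forall a, 0 < a < r -> lower_growth d a).

Let ratio (n k : nat) := d (n + k)%N / d k.

Lemma growth_root_cvg : d n `^ n%:R^-1 @[n --> \oo] --> r.
Proof.
apply: root_cvg => // [n|b /ubd[C C0 HC]|a /lbd[C C0 HC]]; first exact: ltW.
  exists (C * d 0%N) => n; have := HC 0%N n; rewrite add0n; lra.
exists (C * d 0%N); first by rewrite mulr_gt0.
by move=> n; have := HC 0%N n; rewrite add0n; lra.
Qed.

Variable K : set nat.
Hypothesis K0 : K !=set0.

Let ratio_ub n : exists M, ubound [set ratio n k | k in K] M.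
Proof.
have [|C C0 HC] := ubd (b := r + 1); first lra.
exists (C * (r + 1) ^+ n) => _ [k _ <-].
by rewrite ler_pdivrMr// addnC.
Qed.

Let ratio_has_sup n : has_sup [set ratio n k | k in K].
Proof. by split; [case: K0 => k Kk; exists (ratio n k), k|exact: ratio_ub]. Qed.

Let ratio_gt0 n k : 0 < ratio n k.
Proof. by rewrite divr_gt0. Qed.

Let ratio_has_inf n : has_inf [set ratio n k | k in K].
Proof.
split; first by case: K0 => k Kk; exists (ratio n k), k.
by exists 0 => _ [k _ <-]; apply/ltW/ratio_gt0.
Qed.

Lemma growth_sup_cvg :
  sup [set ratio n k | k in K] `^ n%:R^-1 @[n --> \oo] --> r.
Proof.
have [k0 Kk0] := K0.
have le_sup n : ratio n k0 <= sup [set ratio n k | k in K].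
  by apply: sup_upper_bound => //; exists k0.
apply: root_cvg => // [n|b /ubd[C C0 HC]|a /lbd[C C0 HC]].
- by apply: le_trans (le_sup n); apply/ltW/ratio_gt0.
- exists C => n; apply: ge_sup; first by case: (ratio_has_sup n).
  by move=> _ [k _ <-]; rewrite ler_pdivrMr// addnC.
- exists C => // n; apply: le_trans (le_sup n).
  by rewrite ler_pdivlMr// addnC.
Qed.

Lemma growth_inf_cvg :
  inf [set ratio n k | k in K] `^ n%:R^-1 @[n --> \oo] --> r.
Proof.
have [k0 Kk0] := K0.
have inf_le n : inf [set ratio n k | k in K] <= ratio n k0.
  by apply: ge_inf; [case: (ratio_has_inf n)|exists k0].
apply: root_cvg => // [n|b /ubd[C C0 HC]|a /lbd[C C0 HC]].
- apply: lb_le_inf; first by case: (ratio_has_inf n).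
  by move=> _ [k _ <-]; apply/ltW/ratio_gt0.
- exists C => n; apply: le_trans (inf_le n) _.
  by rewrite ler_pdivrMr// addnC.
- exists C => // n; apply: lb_le_inf; first by case: (ratio_has_inf n).
  by move=> _ [k _ <-]; rewrite ler_pdivlMr// addnC.
Qed.

End Rates.

(** The threshold is the infimum of the rates b that bound all windows from above;
    below it no upper bound holds, so the dichotomy supplies the lower one. *)
Lemma growth_threshold d : (forall n, 0 < d n) ->
  (exists2 M, 0 < M & upper_growth d M) ->
  (forall a b, 0 < a -> a < b -> upper_growth d b \/ lower_growth d a) ->
  exists2 r, 0 <= r & (forall b, r < b -> upper_growth d b) /\
                      (forall a, 0 < a < r -> lower_growth d a).
Proof.
move=> d0 [M M0 uM] dich.
set B := [set b | 0 < b /\ upper_growth d b].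
have infB : has_inf B by split; [exists M|exists 0 => b [/ltW]].
have mono b b' : 0 < b -> b <= b' -> upper_growth d b -> upper_growth d b'.
  move=> b0 bb' [C C0 HC]; exists C => // i n; apply: le_trans (HC i n) _.
  rewrite ler_pM2r// ler_pM2l// lerXn2r// nnegrE ltW//; exact: lt_le_trans bb'.
exists (inf B); first by apply: lb_le_inf; [case: infB|move=> b [/ltW]].
split=> [b|a /andP[a0 aB]].
  move=> /(inf_lt infB.1) [b' [b'0 ub'] b'b]; exact: mono (ltW b'b) ub'.
have [] := dich a ((a + inf B) / 2) a0; [lra| |by []].
move=> u; have : B ((a + inf B) / 2) by split=> //; lra.
by move=> /(ge_inf infB.2); lra.
Qed.

(** Shifting the starting point by one step changes the constant only, since a window
    starting at J is its first step followed by a window starting at J+1.  It lets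
    one look for violations of a growth bound arbitrarily far away. *)
Lemma upper_growth_tail d b J : (forall n, 0 < d n) -> 0 < b ->
  upper_growth (fun i => d (J + i)%N) b -> upper_growth d b.
Proof.
move=> d0 b0; elim: J => [//|J IH] [C C0 HC]; apply: IH.
set dj := fun i => _.
have dj0 i : 0 < dj i by exact: d0.
set D := Num.max 1 (Num.max C (C * dj 1%N / (b * dj 0%N))).
exists D => [|i n]; first by rewrite /D lt_max ltr01.
have bn k : 0 < b ^+ k by rewrite exprn_gt0.
have HC' k m : dj (k.+1 + m)%N <= C * b ^+ m * dj k.+1.
  by have := HC k m; rewrite /dj !addSn !addnS.
case: i => [|i].
  case: n => [|n].
    rewrite addn0 expr0 mulr1; apply: ler_peMl; first exact: ltW.
    by rewrite /D le_max lexx.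
  rewrite add0n -add1n; apply: le_trans (HC' 0%N n) _.
  have : C * dj 1%N / (b * dj 0%N) <= D by rewrite /D !le_max lexx !orbT.
  rewrite ler_pdivrMr ?mulr_gt0// => h.
  rewrite add1n exprS; have := bn n; nra.
apply: le_trans (HC' i n) _.
by rewrite ler_pM2r// ler_pM2r// /D !le_max lexx !orbT.
Qed.

Lemma lower_growthV d a : (forall n, 0 < d n) -> 0 < a ->
  upper_growth (fun i => (d i)^-1) a^-1 -> lower_growth d a.
Proof.
move=> d0 a0 [C C0 HC]; exists C^-1 => [|i n]; first by rewrite invr_gt0.
have := HC i n; rewrite -[C in X in X -> _]invrK exprVn -!invfM.
by rewrite lef_pV2// posrE ?mulr_gt0 ?invr_gt0 ?exprn_gt0.
Qed.

Lemma upper_growthV d a : (forall n, 0 < d n) -> 0 < a ->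
  lower_growth d a -> upper_growth (fun i => (d i)^-1) a^-1.
Proof.
move=> d0 a0 [C C0 HC]; exists C^-1 => [|i n]; first by rewrite invr_gt0.
rewrite exprVn -!invfM lef_pV2 ?posrE ?mulr_gt0 ?invr_gt0 ?exprn_gt0//.
Qed.

Lemma lower_growth_tail d a J : (forall n, 0 < d n) -> 0 < a ->
  lower_growth (fun i => d (J + i)%N) a -> lower_growth d a.
Proof.
move=> d0 a0 lo; apply: lower_growthV => //.
apply: (@upper_growth_tail _ _ J); [by move=> n; rewrite invr_gt0| |].
  by rewrite invr_gt0.
by apply: (upper_growthV _ a0 lo) => n.
Qed.

(** Let X be the sum over [k, n).  Once X exceeds 2 D s_k the hypothesis gives
    X <= 2 D s_n, so that X is multiplied by at least 1 + 1/(2D) when n increases: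
    exponential growth.  If this never happens, every tail sum is at most 2 D times
    its first term, so tail sums decrease by a constant factor: exponential decay. *)
Lemma endpoint_dichotomy (s : nat -> R) (D : R) : 0 < D -> (forall n, 0 < s n) ->
  (forall k n, (k <= n)%N -> \sum_(k <= j < n) s j <= D * (s k + s n)) ->
  (exists t C, [/\ 1 < t, 0 < C & forall n, C * t ^+ n <= s n]) \/
  (exists t C, [/\ 0 < t, t < 1 & forall n, s n <= C * t ^+ n]).
Proof.
move=> D0 s0 H.
have mono k n : (k <= n)%N ->
    \sum_(k <= j < n.+1) s j = \sum_(k <= j < n) s j + s n.
  by move=> kn; rewrite big_nat_recr.
have [[k [n [kn big]]]|small] := pselect (exists k n, (k <= n)%N /\
    2 * D * s k < \sum_(k <= j < n) s j).
  left.
  pose t := 1 + (2 * D)^-1.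
  have t1 : 1 < t by rewrite /t ltrDl invr_gt0 mulr_gt0.
  have grow m : 2 * D * s k * t ^+ m <= \sum_(k <= j < n + m) s j.
    elim: m => [|m IH]; first by rewrite expr0 mulr1 addn0 ltW.
    rewrite addnS mono ?ltn_addr//; last exact: leq_trans (leq_addr _ _).
    set X := \sum_(k <= j < n + m) s j in IH *.
    have tm : 1 <= t ^+ m by apply: exprn_ege1; exact: ltW.
    have sk := s0 k.
    have h : X <= D * (s k + s (n + m)%N) by apply/H/(leq_trans kn)/leq_addr.
    have h2 : 2 * D * s k <= X.
      by apply: le_trans IH; rewrite ler_peMr// !mulr_ge0// ltW.
    have h3 : X / (2 * D) <= s (n + m)%N.
      rewrite ler_pdivrMr ?mulr_gt0//; nra.
    rewrite exprSr mulrA.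
    apply: (@le_trans _ _ (X * t)); first by rewrite ler_wpM2r// ltW// (lt_trans ltr01).
    by rewrite /t mulrDr mulr1 lerD2l.
  have grow2 m : s k * t ^+ m <= s (n + m)%N.
    have := grow m; have h : \sum_(k <= j < n + m) s j <= D * (s k + s (n + m)%N).
      by apply/H/(leq_trans kn)/leq_addr.
    move=> h2; have h3 := le_trans h2 h.
    have tm : 1 <= t ^+ m by apply: exprn_ege1; exact: ltW.
    have := s0 k; have : 2 * s k * t ^+ m <= s k + s (n + m)%N.
      by rewrite -(ler_pM2l D0); lra.
    nra.
  exists t.
  have [C C0 HC] : exists2 C, 0 < C & forall i, (i < n)%N -> C * t ^+ i <= s i.
    elim: (n) => [|p [C C0 HC]]; first by exists 1.
    exists (Num.min C (s p / t ^+ p)).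
      by rewrite lt_min C0 divr_gt0// exprn_gt0// (lt_trans ltr01).
    have tp i : 0 < t ^+ i by rewrite exprn_gt0// (lt_trans ltr01).
    move=> i; rewrite ltnS leq_eqVlt => /orP[/eqP->|/HC h].
      by rewrite -ler_pdivlMr// ge_min lexx orbT.
    by apply: le_trans h; rewrite ler_pM2r// ge_min lexx.
  exists (Num.min C (s k / t ^+ n)); split=> //.
    by rewrite lt_min C0 divr_gt0// exprn_gt0// (lt_trans ltr01).
  have tp i : 0 < t ^+ i by rewrite exprn_gt0// (lt_trans ltr01).
  move=> i; have [/HC h|ni] := ltnP i n.
    by apply: le_trans h; rewrite ler_pM2r// ge_min lexx.
  rewrite -{2}(subnKC ni); apply: le_trans (grow2 _).
  rewrite -{1}(subnKC ni) exprD mulrA ler_pM2r// -ler_pdivlMr//.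
  by rewrite ge_min lexx orbT.
right.
have {}small k n : (k <= n)%N -> \sum_(k <= j < n) s j <= 2 * D * s k.
  by move=> kn; rewrite leNgt; apply/negP => h; apply: small; exists k, n.
have D12 : 1 <= 2 * D.
  by have := small 0%N 1%N isT; rewrite big_nat1 -ler_pdivrMr// divff ?gt_eqF.
(* the denominator 2 D + 1, rather than 2 D, ensures t > 0 *)
pose t := 1 - (2 * D + 1)^-1.
have D21 : 0 < 2 * D + 1 by lra.
have tE : t = 2 * D / (2 * D + 1).
  by rewrite /t; field; rewrite gt_eqF.
exists t, (2 * D * s 0%N); split.
- by rewrite tE divr_gt0// mulr_gt0.
- by rewrite /t gtrDl oppr_lt0 invr_gt0.
have tail n k : (k <= n)%N ->
    \sum_(k <= j < n.+1) s j <= t ^+ k * (2 * D * s 0%N).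
  elim: k => [_|k IH kn]; first by rewrite expr0 mul1r small.
  have kn' : (k <= n)%N by exact: ltnW.
  apply: le_trans (_ : t * \sum_(k <= j < n.+1) s j <= _).
    have h := small k n.+1 (leqW kn').
    rewrite big_ltn ?ltnS// in h *.
    set X := \sum_(k.+1 <= j < n.+1) s j in h *.
    have sk := s0 k; rewrite tE mulrAC ler_pdivlMr//. nra.
  rewrite exprS -mulrA ler_wpM2l ?IH// tE divr_ge0// ltW// mulr_gt0//.
move=> n; have := tail n n (leqnn n); rewrite big_nat1; lra.
Qed.

End Growth.

(** * Complex norms as real numbers *)
Section RealNorm.
Variables (R : realType) (V : normedModType R[i]).
Implicit Types (x y : V) (z : R[i]) (e : R).

(** Norms over R[i] take complex values that happen to be real; the estimates of this
    file are between elements of R. *)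
Definition rnorm x : R := complex.Re `|x|.

Lemma rnormE x : `|x| = (rnorm x)%:C.
Proof.
have := normr_ge0 x; rewrite /rnorm; case: `|x| => a b.
by rewrite lecE /= => /andP[/eqP-> _].
Qed.

Lemma normc_norm z : `|z| = (normc z)%:C.
Proof. by []. Qed.

Lemma rnorm_ge0 x : 0 <= rnorm x.
Proof. by rewrite -(@lecR R) -rnormE normr_ge0. Qed.

Lemma rnorm0 : rnorm 0 = 0.
Proof. by rewrite /rnorm normr0. Qed.

Lemma rnorm_eq0 x : rnorm x = 0 -> x = 0.
Proof. by move=> h; apply/eqP; rewrite -normr_eq0 rnormE h. Qed.

Lemma rnormN x : rnorm (- x) = rnorm x.
Proof. by rewrite /rnorm normrN. Qed.

Lemma rnormB x y : rnorm (x - y) = rnorm (y - x).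
Proof. by rewrite -rnormN opprB. Qed.

Lemma rnormD x y : rnorm (x + y) <= rnorm x + rnorm y.
Proof. by rewrite -(@lecR R) rmorphD/= -!rnormE ler_normD. Qed.

Lemma rnorm_distD x y : rnorm (x - y) <= rnorm x + rnorm y.
Proof. by rewrite (le_trans (rnormD _ _))// rnormN. Qed.

Lemma rnormZ z x : rnorm (z *: x) = normc z * rnorm x.
Proof.
apply: (@complexI R); rewrite -rnormE normrZ rnormE rmorphM/=.
by congr (_ * _).
Qed.

Lemma rnorm_sum I (r : seq I) (P : pred I) (F : I -> V) :
  rnorm (\sum_(i <- r | P i) F i) <= \sum_(i <- r | P i) rnorm (F i).
Proof.
elim/big_ind2: _ => //; first by rewrite rnorm0.
by move=> x1 x2 y1 y2 h1 h2; rewrite (le_trans (rnormD _ _))// lerD.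
Qed.

Lemma ltc_real z : 0 < z -> exists2 e, 0 < e & z = e%:C.
Proof.
case: z => a b; rewrite ltcE /= => /andP[/eqP-> a0].
by exists a.
Qed.

Lemma cvg_rnormP (u : nat -> V) x : u n @[n --> \oo] --> x <->
  forall e, 0 < e -> exists n0, forall n, (n0 <= n)%N -> rnorm (x - u n) <= e.
Proof.
split=> [/cvgrPdist_le h e e0|h].
  have [|n0 _ Hn0] := h e%:C; first by rewrite ltcR.
  by exists n0 => n /Hn0 /=; rewrite rnormE lecR.
apply/cvgrPdist_le => _ /ltc_real[e e0 ->].
have [n0 Hn0] := h _ e0; exists n0 => // n /Hn0 /=.
by rewrite rnormE lecR.
Qed.

Lemma nbhs_rnormP x (A : set V) : nbhs x A <->
  exists2 e, 0 < e & forall y, rnorm (x - y) < e -> A y.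
Proof.
split=> [/nbhs_ballP[_ /ltc_real[e e0 ->]] h|[e e0 h]].
  by exists e => // y xy; apply: h; rewrite -ball_normE /= rnormE ltcR.
apply/nbhs_ballP; exists e%:C; first by rewrite /= ltcR.
by move=> y; rewrite -ball_normE /= rnormE ltcR; exact: h.
Qed.

Lemma closure_rnormP (A : set V) x : closure A x <->
  forall e, 0 < e -> exists2 y, A y & rnorm (x - y) < e.
Proof.
split=> [clA e e0|h B /nbhs_rnormP[e e0 hB]].
  have [|y [Ay By]] := clA [set y | rnorm (x - y) < e].
    by apply/nbhs_rnormP; exists e.
  by exists y.
by have [y Ay xy] := h e e0; exists y; split=> //; exact: hB.
Qed.

End RealNorm.

Section Normc.
Variable R : realType.
Implicit Types (x y z : R[i]) (a : R).

Lemma normc_rnorm z : normc z = rnorm (z : R[i]^o). Proof. by []. Qed.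
Lemma normc_ge0 z : 0 <= normc z.
Proof. exact: (@rnorm_ge0 _ R[i]^o). Qed.
Lemma ler_normcD x y : normc (x + y) <= normc x + normc y.
Proof. exact: (@rnormD _ R[i]^o). Qed.
Lemma ler_normcB x y : normc x - normc y <= normc (x - y).
Proof. by rewrite lerBlDr; apply: le_trans (ler_normcD _ _); rewrite subrK. Qed.
Lemma normc_eq0 z : normc z = 0 -> z = 0.
Proof. exact: (@rnorm_eq0 _ R[i]^o). Qed.
Lemma normc_gt0 z : (0 < normc z) = (z != 0).
Proof.
rewrite lt_neqAle normc_ge0 andbT eq_sym; congr negb.
by apply/eqP/eqP => [/normc_eq0//|->]; exact: ComplexField.Normc.normc0.
Qed.
Lemma normcX z n : normc (z ^+ n) = normc z ^+ n.
Proof.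
elim: n => [|n IH]; first by rewrite !expr0 ComplexField.Normc.normc1.
by rewrite !exprS ComplexField.Normc.normcM IH.
Qed.
Lemma normcXz z (n : int) : normc (z ^ n) = normc z ^ n.
Proof.
case: n => n; first exact: normcX.
by rewrite NegzE -!exprnN ComplexField.Normc.normcV normcX.
Qed.
Lemma normc_real a : normc a%:C = `|a|.
Proof. by rewrite /ComplexField.Normc.normc /= expr0n /= addr0 sqrtr_sqr. Qed.

End Normc.

(** * Vector-valued power series *)
Section Taylor.
Variable R : realType.
Implicit Types (z h : R[i]) (eta : R).

Lemma ler_expr (x y : R) n : 0 <= x -> x <= y -> x ^+ n <= y ^+ n.
Proof.
by move=> x0 xy; rewrite lerXn2r// nnegrE// (le_trans x0).
Qed.

Lemma expr_derivS z q :
  q.+1%:R * z ^+ q = z * (q%:R * z ^+ q.-1) + z ^+ q.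
Proof.
case: q => [|q] /=; first by rewrite mul0r mulr0 add0r mul1r.
by rewrite mulrCA -exprS -natr1 mulrDl mul1r.
Qed.

Lemma normc_expr_deriv z eta q : 0 <= eta ->
  normc (q%:R * z ^+ q.-1) * eta <= (normc z + eta) ^+ q.
Proof.
move=> eta0; have z0 := normc_ge0 z.
elim: q => [|q IH].
  by rewrite mul0r ComplexField.Normc.normc0 mul0r expr0.
rewrite expr_derivS exprS mulrDl.
apply: le_trans (ler_wpM2r eta0 (ler_normcD _ _)) _.
rewrite mulrDl ComplexField.Normc.normcM -mulrA lerD ?ler_wpM2l//.
by rewrite mulrC ler_wpM2l// normcX ler_expr// lerDl.
Qed.

Lemma normc_expr_diff z h eta q : normc h <= eta ->
  normc ((z + h) ^+ q - z ^+ q) * eta <= normc h * (normc z + eta) ^+ q.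
Proof.
have z0 := normc_ge0 z; have h0 := normc_ge0 h => he.
have eta0 := le_trans h0 he.
elim: q => [|q IH].
  rewrite !expr0 subrr ComplexField.Normc.normc0 mul0r mulr1//.
have -> : (z + h) ^+ q.+1 - z ^+ q.+1 =
    z * ((z + h) ^+ q - z ^+ q) + h * (z + h) ^+ q by rewrite !exprS; ring.
have B : normc ((z + h) ^+ q) * eta <= (normc z + eta) ^+ q * eta.
  rewrite ler_wpM2r// normcX ler_expr ?normc_ge0//.
  by apply: le_trans (ler_normcD _ _) _; rewrite lerD2l.
apply: le_trans (ler_wpM2r eta0 (ler_normcD _ _)) _.
rewrite !ComplexField.Normc.normcM exprS.
have := ler_wpM2l z0 IH; have := ler_wpM2l h0 B; lra.
Qed.

(** The bound has no factor depending on q besides (|z| + eta)^q: the binomial sum over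
    i >= 2 of C(q,i) |z|^(q-i) |h|^i is at most (|h|/eta)^2 times the same sum with eta
    in place of |h|.  Hence it can be summed against any series converging at the
    radius |z| + eta. *)
Lemma normc_expr_taylor z h eta q : normc h <= eta ->
  normc ((z + h) ^+ q - z ^+ q - h * (q%:R * z ^+ q.-1)) * eta ^+ 2
    <= normc h ^+ 2 * (normc z + eta) ^+ q.
Proof.
have z0 := normc_ge0 z; have h0 := normc_ge0 h => he.
have eta0 := le_trans h0 he.
elim: q => [|q IH].
  rewrite !expr0 mul0r mulr0 subr0 subrr ComplexField.Normc.normc0 mul0r mulr1.
  exact: exprn_ge0.
have -> : (z + h) ^+ q.+1 - z ^+ q.+1 - h * (q.+1%:R * z ^+ q) =
    z * ((z + h) ^+ q - z ^+ q - h * (q%:R * z ^+ q.-1))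
    + h * ((z + h) ^+ q - z ^+ q).
  by rewrite expr_derivS !exprS; ring.
apply: le_trans (ler_wpM2r (exprn_ge0 _ eta0) (ler_normcD _ _)) _.
rewrite !ComplexField.Normc.normcM [X in _ <= _ * X]exprS.
have := ler_wpM2l (mulr_ge0 h0 eta0) (normc_expr_diff z q he).
have := ler_wpM2l z0 IH; rewrite !expr2; lra.
Qed.

End Taylor.

Lemma subrACA (V : zmodType) (x y z t : V) :
  (x - y) - (z - t) = (x - z) - (y - t).
Proof. by rewrite !opprD addrACA. Qed.

Section Series.
Variables (R : realType) (H : completeNormedModType R[i]).
Implicit Types (v : nat -> H) (C theta : R).

Lemma derivable_quadratic (f : R[i]^o -> H) (z : R[i]^o) (L : H) (K r : R) :
  0 < r ->
  (forall h : R[i], normc h < r ->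
     rnorm (f (z + h) - f z - h *: L) <= K * normc h ^+ 2) ->
  derivable f z 1.
Proof.
move=> r0 fL; apply/cvg_ex; exists L; apply/cvgrPdist_le => e /ltc_real[d d0 ->].
pose t := Num.min r (d / (1 + `|K|)).
have K1 : 0 < 1 + `|K| by rewrite ltr_wpDr.
have t0 : 0 < t by rewrite lt_min r0 divr_gt0.
have : nbhs (0 : R[i]^o) [set h : R[i]^o | normc h < t].
  by apply/nbhs_rnormP; exists t => // y; rewrite sub0r rnormN.
apply: filterS => h /= ht h0.
have hr : normc h < r by apply: lt_le_trans ht _; rewrite ge_min lexx.
have hd : normc h < d / (1 + `|K|).
  by apply: lt_le_trans ht _; rewrite ge_min lexx orbT.
rewrite rnormE lecR.
have -> : (h *: 1 + z : R[i]^o) = z + h by rewrite addrC; congr (_ + _); exact: mulr1.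
have -> : L - h^-1 *: (f (z + h) - f z) = - h^-1 *: (f (z + h) - f z - h *: L).
  rewrite [in RHS]scalerBr scalerA -[X in _ = X - _]opprK -scaleNr opprK mulNr mulVf//.
  by rewrite scaleN1r opprK addrC scaleNr.
rewrite rnormZ -[_ (- h^-1)]/(rnorm (- h^-1 : R[i]^o)) rnormN -normc_rnorm.
rewrite ComplexField.Normc.normcV.
have hn0 : 0 < normc h by rewrite normc_gt0.
rewrite mulrC ler_pdivrMr//; apply: le_trans (fL h hr) _.
have := hd; rewrite ltr_pdivlMr// => hd'.
have := ler_norm K; have := normr_ge0 K; nra.
Qed.

Lemma geometric_series_cvg v C theta : 0 <= C -> 0 <= theta -> theta < 1 ->
  (forall m, rnorm (v m) <= C * theta ^+ m) ->
  exists l : H, forall M,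
    rnorm (l - \sum_(m < M) v m) <= C * theta ^+ M / (1 - theta).
Proof.
move=> C0 t0 t1 vC; have t1' : 0 < 1 - theta by lra.
pose s n := \sum_(m < n) v m.
have tail n k : rnorm (s (n + k)%N - s n) <= C * theta ^+ n / (1 - theta).
  suff : rnorm (s (n + k)%N - s n) <= C * theta ^+ n * (1 - theta ^+ k) / (1 - theta).
    move/le_trans; apply; rewrite ler_pM2r ?invr_gt0// ler_piMr//.
      by rewrite mulr_ge0// exprn_ge0.
    by rewrite gerBl exprn_ge0.
  elim: k => [|k IH]; first by rewrite addn0 !subrr mulr0 mul0r rnorm0.
  rewrite addnS {1}/s big_ord_recr /= -/(s _) addrAC.
  apply: le_trans (rnormD _ _) (le_trans (lerD IH (vC _)) _).
  rewrite -[X in _ + X](mulfK (lt0r_neq0 t1')).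
  by rewrite -mulrDl ler_pM2r ?invr_gt0// exprD exprS; lra.
have small e : 0 < e ->
    exists n0, forall n, (n0 <= n)%N -> C * theta ^+ n / (1 - theta) <= e.
  move=> e0.
  have : (fun n => C / (1 - theta) * theta ^+ n) @ \oo --> C / (1 - theta) * 0.
    by apply: cvgMr; apply: cvg_expr; rewrite ger0_norm.
  rewrite mulr0 => /cvgrPdist_le/(_ e e0)[n0 _ Hn0]; exists n0 => n /Hn0 /=.
  by rewrite sub0r normrN => h; apply: le_trans h; rewrite mulrAC ler_norm.
have : cauchy (s n @[n --> \oo]).
  apply/cauchy_exP => _ /ltc_real[e e0 ->].
  have [|n0 Hn0] := small (e / 2); first lra.
  exists (s n0); exists n0 => // n /= nn0; rewrite -ball_normE /= rnormE ltcR.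
  rewrite rnormB -(subnKC nn0); apply: le_lt_trans (tail _ _) _.
  by have := Hn0 n0 (leqnn _); lra.
move/cauchy_cvg/cvg_ex => [l /cvg_rnormP sl]; exists l => M.
apply/ler_addgt0Pr => e e0; have [n0 Hn0] := sl e e0.
rewrite -[l - _](subrKA (s (M + n0)%N)) addrC.
apply: le_trans (rnormD _ _) _; rewrite lerD// ?tail//.
by apply: Hn0; rewrite leq_addl.
Qed.

(** The exponents q m are arbitrary, possibly repeated or non monotone, as required by
    the sparse Laurent series built from peaks.  Differentiability comes from summing
    the second-order estimate of [normc_expr_taylor] term by term. *)
Lemma power_series_derivable (q : nat -> nat) v (rho C theta : R) :
  0 < rho -> 0 <= C -> 0 <= theta -> theta < 1 ->
  (forall m, rnorm (v m) * rho ^+ q m <= C * theta ^+ m) ->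
  exists G : R[i]^o -> H,
    (forall z : R[i]^o, normc z < rho -> derivable G z 1) /\
    (forall (z : R[i]^o) M, normc z < rho ->
       rnorm (G z - \sum_(m < M) (z : R[i]) ^+ q m *: v m)
         <= C * theta ^+ M / (1 - theta)).
Proof.
move=> rho0 C0 t0 t1 vC; have t1' : 0 < 1 - theta by lra.
have /choice[G HG] : forall z : R[i]^o, exists l : H, normc z < rho -> forall M,
    rnorm (l - \sum_(m < M) (z : R[i]) ^+ q m *: v m)
      <= C * theta ^+ M / (1 - theta).
  move=> z; have [zr|//] := boolP (normc z < rho); last by exists 0.
  have [|l Hl] :=
      @geometric_series_cvg (fun m => (z : R[i]) ^+ q m *: v m) _ _ C0 t0 t1.
    move=> m; apply: le_trans (vC m); rewrite rnormZ mulrC ler_wpM2l ?rnorm_ge0//.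
    by rewrite normcX ler_expr ?normc_ge0// ltW.
  by exists l.
exists G; split=> [z zr|z M zr]; last exact: HG.
pose eta := (rho - normc z) / 2.
have eta0 : 0 < eta by rewrite /eta; lra.
have zeta : normc z + eta <= rho by rewrite /eta; lra.
have vC' m : rnorm (v m) * (normc z + eta) ^+ q m <= C * theta ^+ m.
  apply: le_trans (vC m); rewrite ler_wpM2l ?rnorm_ge0//.
  by rewrite ler_expr// addr_ge0 ?normc_ge0// ltW.
pose dv m := ((q m)%:R * (z : R[i]) ^+ (q m).-1) *: v m.
have [||L HL] := @geometric_series_cvg dv (C / eta) _ _ t0 t1.
- by rewrite divr_ge0// ltW.
- move=> m; rewrite mulrAC ler_pdivlMr//; apply: le_trans (vC' m).
  rewrite rnormZ mulrAC mulrC ler_wpM2l ?rnorm_ge0//.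
  by apply: normc_expr_deriv; exact: ltW.
apply: (@derivable_quadratic _ _ L (C / (1 - theta) / eta ^+ 2) eta) => // h hr.
have hz : normc (z + h) < rho.
  by apply: le_lt_trans (ler_normcD _ _) _; rewrite /eta in hr *; lra.
apply/ler_addgt0Pr => e e0.
have [M HM] : exists M, (C + C + normc h * (C / eta)) * theta ^+ M / (1 - theta) <= e.
  have : (fun n => (C + C + normc h * (C / eta)) / (1 - theta) * theta ^+ n) @ \oo
      --> (C + C + normc h * (C / eta)) / (1 - theta) * 0.
    by apply: cvgMr; apply: cvg_expr; rewrite ger0_norm.
  rewrite mulr0 => /cvgrPdist_le/(_ e e0)[n0 _ Hn0]; exists n0.
  have := Hn0 n0 (leqnn _); rewrite /= sub0r normrN => h1.
  by apply: le_trans h1; rewrite mulrAC ler_norm.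
pose s (x : R[i]) := \sum_(m < M) x ^+ q m *: v m.
pose ds := \sum_(m < M) dv m.
set A := s (z + h) - s z - h *: ds.
set B := (G (z + h) - s (z + h)) - (G z - s z) - h *: (L - ds).
have -> : G (z + h) - G z - h *: L = A + B.
  by rewrite /A /B scalerBr (subrACA (G _)) (subrACA (G _ - G _)) subrKC.
apply: (le_trans (rnormD A B)). apply: lerD.
  rewrite /A /s /ds scaler_sumr -!sumrB.
  apply: le_trans (rnorm_sum _ _ _) _.
  apply: (@le_trans _ _ (\sum_(m < M) C * theta ^+ m * (normc h ^+ 2 / eta ^+ 2))).
    apply: ler_sum => m _; rewrite /dv scalerA -!scalerBl rnormZ.
    rewrite [leRHS]mulrA ler_pdivlMr ?exprn_gt0//.
    have h1 := ler_wpM2r (rnorm_ge0 (v m)) (normc_expr_taylor z (q m) (ltW hr)).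
    have h2 := ler_wpM2l (exprn_ge0 2 (normc_ge0 h)) (vC' m).
    rewrite mulrAC; apply: (le_trans h1); lra.
  rewrite -mulr_suml -mulr_sumr.
  have geo : \sum_(m < M) theta ^+ m <= (1 - theta)^-1.
    rewrite -[leRHS]mul1r ler_pdivlMr// mulrC -[X in (X - theta) * _](expr1n _ M).
    have := subrXX 1 theta M.
    rewrite expr1n; under [in X in _ = X -> _]eq_bigr => i _ do rewrite expr1n mul1r.
    by move=> <-; rewrite gerBl exprn_ge0.
  have -> : C / (1 - theta) / eta ^+ 2 * normc h ^+ 2 =
     C * (1 - theta)^-1 * (normc h ^+ 2 / eta ^+ 2) by ring.
  rewrite ler_wpM2r ?divr_ge0 ?exprn_ge0 ?normc_ge0 ?(ltW eta0)//.
  by rewrite ler_wpM2l.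
(* A is the second-order remainder of the partial sum, B collects the tails *)
have hB : rnorm B <= rnorm (G (z + h) - s (z + h)) + rnorm (G z - s z)
    + normc h * rnorm (L - ds).
  by rewrite -rnormZ; apply: (le_trans (rnorm_distD _ _)); rewrite lerD2r rnorm_distD.
apply: (le_trans hB); apply: le_trans HM.
have h1 := ler_wpM2l (normc_ge0 h) (HL M).
apply: (le_trans (lerD (lerD (HG _ hz M) (HG _ zr M)) h1)).
by rewrite le_eqVlt; apply/orP; left; apply/eqP; ring.
Qed.

End Series.

(** * The recursion for the weights beta *)
Section Beta.
Variables (R : realType) (w : int -> R).
Hypothesis w0 : forall n, 0 < w n.

Lemma beta0 : beta w 0 = 1.
Proof. by rewrite /beta /= big_ord0. Qed.

Lemma beta_gt0 n : 0 < beta w n.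
Proof. by case: n => m; rewrite /beta ?invr_gt0 prodr_gt0. Qed.

Lemma betaS n : beta w (n + 1) = w n * beta w n.
Proof.
case: n => [m|[|m]].
- by rewrite -PoszD addn1 /= big_ord_recr /= mulrC.
- rewrite (_ : Negz 0 + 1 = 0)// beta0 /= big_ord1 /=.
  by rewrite (_ : (- Posz 1) = Negz 0)// divff// gt_eqF.
- rewrite (_ : Negz m.+1 + 1 = Negz m); last by rewrite !NegzE; lia.
  rewrite /= [in RHS]big_ord_recr /= invfM mulrCA mulfV ?mulr1//.
  by rewrite gt_eqF.
Qed.

End Beta.

(** * Bounded operators and their inverses *)
Section BoundedOperators.
Variables (R : realType) (V : normedModType R[i]).
Implicit Types (A : {linear V -> V}) (x y : V) (C : R).

Definition bounded_op (A : V -> V) :=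
  exists2 C, 0 < C & forall x, rnorm (A x) <= C * rnorm x.

Lemma continuous_bounded A : continuous A -> bounded_op A.
Proof.
move=> cA.
have h1 : nbhs (A 0) [set y | rnorm y < 1].
  by apply/nbhs_rnormP; exists 1 => // y; rewrite linear0 sub0r rnormN.
have /nbhs_rnormP[e e0 he] := cA 0 _ h1.
exists (2 / e) => [|x]; first by rewrite divr_gt0.
have [->|x0] := eqVneq x 0; first by rewrite linear0 rnorm0 mulr0.
have nx : 0 < rnorm x.
  by rewrite lt_neqAle rnorm_ge0 andbT eq_sym; apply: contra_neq x0; exact: rnorm_eq0.
pose t := e / (2 * rnorm x).
have t0 : 0 < t by rewrite divr_gt0// mulr_gt0.
have := he (t%:C *: x).
rewrite /= sub0r rnormN linearZ /= !rnormZ normc_real gtr0_norm//.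
have -> : t * rnorm x = e / 2 by rewrite /t; field; rewrite gt_eqF.
have -> : e / 2 < e by lra.
move=> /(_ isT); rewrite /t mulrAC ltr_pdivrMr ?mulr_gt0// mul1r.
by rewrite mulrAC ler_pdivlMr// => /ltW; rewrite [leLHS]mulrC.
Qed.

Lemma bounded_continuous A : bounded_op A -> continuous A.
Proof.
move=> [C C0 HC] x; apply/cvgrPdist_le => _ /ltc_real[e e0 ->].
have : nbhs x [set y | rnorm (x - y) < e / C].
  by apply/nbhs_rnormP; exists (e / C) => //; rewrite divr_gt0.
apply: filterS => y /= xy; rewrite -linearB rnormE lecR.
apply: (le_trans (HC _)); rewrite mulrC -ler_pdivlMr//; exact: ltW.
Qed.

Lemma bounded_comp (A B : V -> V) :
  bounded_op A -> bounded_op B -> bounded_op (A \o B).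
Proof.
move=> [C C0 HC] [D D0 HD]; exists (C * D); first exact: mulr_gt0.
by move=> x /=; apply: (le_trans (HC _)); rewrite -mulrA ler_wpM2l ?(ltW C0).
Qed.

Lemma bounded_add (A B : V -> V) :
  bounded_op A -> bounded_op B -> bounded_op (fun x => A x + B x).
Proof.
move=> [C C0 HC] [D D0 HD]; exists (C + D); first exact: addr_gt0.
by move=> x /=; apply: (le_trans (rnormD _ _)); rewrite mulrDl lerD.
Qed.

Lemma bounded_scale (z : R[i]) : bounded_op (fun x => z *: x).
Proof.
exists (normc z + 1) => [|x]; first by rewrite ltr_wpDl ?normc_ge0.
by rewrite rnormZ ler_wpM2r ?rnorm_ge0// lerDl.
Qed.

Lemma bounded_iter (A : V -> V) n : bounded_op A -> bounded_op (iter n A).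
Proof.
move=> bA; elim: n => [|n IH]; first by exists 1 => // x; rewrite mul1r.
exact: (bounded_comp bA IH).
Qed.

End BoundedOperators.

Section Inverse.
Variables (R : realType) (V : completeNormedModType R[i]).

(** The lower bound gives injectivity, continuity of the inverse, and closedness of the
    range: if A u_n converges then u_n is a Cauchy sequence. *)
Lemma bounded_below_inverse (A : V -> V) (delta : R) :
  linear A -> bounded_op A -> 0 < delta ->
  (forall x, delta * rnorm x <= rnorm (A x)) ->
  (forall y e, 0 < e -> exists x, rnorm (y - A x) < e) ->
  exists T : {linear V -> V},
    [/\ continuous T, forall x, T (A x) = x & forall x, A (T x) = x].
Proof.
move=> linA [C C0 HC] d0 below dense.
pose lA := GRing.isLinear.Build _ _ _ _ A linA.
pose AL : {linear V -> V} := HB.pack A lA.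
have AB x y : A (x - y) = A x - A y := linearB AL x y.
have injA x y : A x = A y -> x = y.
  move=> Axy; apply/eqP; rewrite -subr_eq0; apply/eqP/rnorm_eq0/eqP.
  rewrite eq_le rnorm_ge0 andbT -(ler_pM2l d0) mulr0.
  by apply: (le_trans (below _)); rewrite AB Axy subrr rnorm0.
have surjA y : exists x, A x = y.
  have /choice[u Hu] : forall n, exists x, rnorm (y - A x) < n.+1%:R^-1.
    by move=> n; apply: dense; rewrite invr_gt0.
  have Auy : A (u n) @[n --> \oo] --> y.
    apply/cvg_rnormP => e e0; exists (Num.truncn e^-1) => n nn.
    apply: (le_trans (ltW (Hu n))); rewrite -[leRHS]invrK lef_pV2 ?posrE ?invr_gt0//.
    by apply: (le_trans (ltW (truncnS_gt _))); rewrite ler_nat.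
  have : cauchy (u n @[n --> \oo]).
    apply/cauchy_exP => _ /ltc_real[e e0 ->].
    have [|n0 Hn0] := (cvg_rnormP _ _).1 Auy (delta * e / 4).
      by rewrite divr_gt0// mulr_gt0.
    exists (u n0); exists n0 => // n /= nn0; rewrite -ball_normE /= rnormE ltcR.
    rewrite -(ltr_pM2l d0); apply: (le_lt_trans (below _)).
    rewrite AB -(subrKA y) addrC -[A (u n0) - y]opprB.
    apply: (le_lt_trans (rnorm_distD _ _)).
    have := Hn0 _ nn0; have := Hn0 _ (leqnn _).
    have := mulr_gt0 d0 e0; lra.
  move/cauchy_cvg/cvg_ex => [x ux]; exists x.
  suff Aux : A (u n) @[n --> \oo] --> A x by exact: (cvg_unique _ Aux Auy).
  apply/cvg_rnormP => e e0.
  have [|n0 Hn0] := (cvg_rnormP _ _).1 ux (e / C); first exact: divr_gt0.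
  exists n0 => n /Hn0; rewrite ler_pdivlMr// mulrC => h.
  by rewrite -AB (le_trans (HC _)).
have /choice[T HT] := surjA.
have linT : linear T.
  by move=> a x y; apply: injA; rewrite HT (linA a (T x) (T y)) !HT.
pose lT := GRing.isLinear.Build _ _ _ _ T linT.
pose TL : {linear V -> V} := HB.pack T lT.
exists TL; split=> //=.
- apply: (bounded_continuous (A := TL)); exists delta^-1; first by rewrite invr_gt0.
  by move=> x /=; rewrite mulrC ler_pdivlMr// mulrC -{2}(HT x); exact: below.
- by move=> x; apply: injA; rewrite HT.
Qed.

End Inverse.

(** * Orthonormal bases *)
Section Basis.
Variables (R : realType) (H : completeNormedModType R[i]).
Variables (dot : {dot H for conjC}) (hdot : norm_from_dot dot).
Variables (e : int -> H) (he : orthonormal_basis dot e).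
Implicit Types (x y : H) (n k : int) (c : int -> R[i]) (s : seq int).

Lemma dotDl x y z : dot (x + y) z = dot x z + dot y z.
Proof. by rewrite linearDl. Qed.
Lemma dotZl a x z : dot (a *: x) z = a * dot x z.
Proof. by rewrite linearZl_LR. Qed.
Lemma dotBl x y z : dot (x - y) z = dot x z - dot y z.
Proof. by rewrite linearBl. Qed.
Lemma dot0l z : dot 0 z = 0.
Proof. by rewrite linear0l. Qed.
Lemma dotDr x y z : dot z (x + y) = dot z x + dot z y.
Proof. by rewrite linearDr. Qed.
Lemma dotZr a x z : dot z (a *: x) = a^* * dot z x.
Proof. by rewrite linearZr_LR. Qed.
Lemma dotC x y : dot x y = (dot y x)^*.
Proof. by rewrite hermC /= expr0 mul1r. Qed.

Lemma dot_basis m n : dot (e m) (e n) = (m == n)%:R.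
Proof. exact: he.1. Qed.

Lemma rnorm_dot x : (rnorm x ^+ 2)%:C = dot x x.
Proof. by rewrite -hdot rnormE rmorphXn. Qed.

Lemma pythagoras x n (a : R[i]) : dot x (e n) = 0 ->
  rnorm (x + a *: e n) ^+ 2 = rnorm x ^+ 2 + normc a ^+ 2.
Proof.
move=> xn; apply: (@complexI R).
rewrite rnorm_dot rmorphD /= rnorm_dot !(dotDl, dotDr, dotZl, dotZr).
rewrite xn (dotC (e n) x) xn rmorph0 dot_basis eqxx !mulr0 addr0 add0r mulr1.
by rewrite rmorphXn /= -normc_norm normCK.
Qed.

Lemma coord_le x n : normc (dot x (e n)) <= rnorm x.
Proof.
have := @pythagoras (x - dot x (e n) *: e n) n (dot x (e n)).
rewrite subrK dotBl dotZl dot_basis eqxx mulr1 subrr => /(_ erefl) h.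
rewrite -(@ler_pXn2r _ 2%N)// ?nnegrE ?normc_ge0 ?rnorm_ge0//.
by rewrite h lerDr exprn_ge0// rnorm_ge0.
Qed.

Lemma rnorm_basis n : rnorm (e n) = 1.
Proof.
have := @pythagoras 0 n 1; rewrite dot0l scale1r add0r rnorm0 expr0n add0r.
rewrite ComplexField.Normc.normc1 expr1n => /(_ erefl)/eqP.
by rewrite sqrp_eq1 ?rnorm_ge0// => /eqP.
Qed.

Lemma dot_sum I (r : seq I) (F : I -> H) z :
  dot (\sum_(i <- r) F i) z = \sum_(i <- r) dot (F i) z.
Proof.
elim: r => [|i r IH]; first by rewrite !big_nil dot0l.
by rewrite !big_cons dotDl IH.
Qed.

Lemma coord_sum s c k : k \notin s -> dot (\sum_(n <- s) c n *: e n) (e k) = 0.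
Proof.
elim: s => [|n s IH]; first by rewrite big_nil dot0l.
rewrite inE negb_or => /andP[kn ks].
by rewrite big_cons dotDl IH// dotZl dot_basis eq_sym (negPf kn) mulr0 addr0.
Qed.

Lemma rnorm_sum_basis s c : uniq s ->
  rnorm (\sum_(n <- s) c n *: e n) ^+ 2 = \sum_(n <- s) normc (c n) ^+ 2.
Proof.
elim: s => [|n s IH]; first by rewrite !big_nil rnorm0 expr0n.
move=> /= /andP[ns us]; rewrite !big_cons addrC pythagoras ?coord_sum// IH//.
by rewrite addrC.
Qed.

(** Repeated indices of a linear combination are merged, so that Pythagoras applies. *)
Lemma basis_dense x (d : R) : 0 < d -> exists s c, uniq s /\
  rnorm (x - \sum_(n <- s) c n *: e n) < d.
Proof.
move=> d0; have : closure [set x : H | exists (s : seq int) (c : int -> R[i]),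
  x = \sum_(n <- s) c n *: e n] x by rewrite he.2.
move/closure_rnormP/(_ _ d0) => [_ [s [c ->]] h].
exists (undup s), (fun n => c n *+ count_mem n s); split; first exact: undup_uniq.
suff <- : \sum_(n <- s) c n *: e n =
    \sum_(n <- undup s) (c n *+ count_mem n s) *: e n by [].
rewrite -big_undup_iterop_count; apply: eq_bigr => n _.
by rewrite -scalerMnl.
Qed.

Lemma dense_rnorm_le (A B : {linear H -> H}) : bounded_op A -> bounded_op B ->
  (forall s c, uniq s ->
     rnorm (A (\sum_(n <- s) c n *: e n)) <= rnorm (B (\sum_(n <- s) c n *: e n))) ->
  forall x, rnorm (A x) <= rnorm (B x).
Proof.
move=> [C C0 HC] [D D0 HD] h x; apply/ler_addgt0Pr => d d0.
have [|s [c [us xs]]] := @basis_dense x (d / (C + D)).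
  by rewrite divr_gt0// addr_gt0.
set y := \sum_(n <- s) _ in xs; have hy := h s c us.
move: xs; rewrite ltr_pdivlMr ?addr_gt0// => xs.
have hA : rnorm (A x) <= rnorm (A y) + C * rnorm (x - y).
  rewrite -[x in A x](subrKC y) linearD; apply: (le_trans (rnormD _ _)).
  by rewrite lerD2l.
have hB : rnorm (B y) <= rnorm (B x) + D * rnorm (x - y).
  rewrite -[y in B y](subrKC x) linearD; apply: (le_trans (rnormD _ _)).
  by rewrite lerD2l (rnormB x).
lra.
Qed.

(** A weak form of Bessel's inequality: outside the support of a finite combination
    close to x, the coordinates of x are those of the difference. *)
Lemma coord_vanish x (d : R) : 0 < d ->
  exists m : nat, forall n, (m <= `|n|)%N -> normc (dot x (e n)) < d.
Proof.
move=> d0; have [s [c [us xs]]] := basis_dense x d0.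
exists (\max_(n <- s) `|n|%N).+1 => n nm.
apply: (le_lt_trans _ xs); rewrite -[dot x (e n)]subr0 -(@coord_sum s c n).
  by rewrite -dotBl coord_le.
by apply/negP => ns; move: nm; rewrite ltnNge leq_bigmax_seq.
Qed.

End Basis.

(** * The formal eigenvector and its truncations *)
Section Shift.
Variables (R : realType) (H : completeNormedModType R[i]).
Variables (dot : {dot H for conjC}) (hdot : norm_from_dot dot).
Variables (e : int -> H) (he : orthonormal_basis dot e).
Variables (w : int -> R) (S : {linear H -> H}).
Hypothesis hS : bilateral_weighted_shift S e w.
Implicit Types (x y : H) (n k : int) (z : R[i]).

Local Notation b := (beta w).

Let w0 n : 0 < w n. Proof. by case: hS. Qed.
Let b0 n : 0 < b n. Proof. exact: beta_gt0. Qed.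
Let Se n : S (e n) = (w n)%:C *: e (n + 1). Proof. by case: hS. Qed.
Let bS n : b (n + 1) = w n * b n. Proof. exact: betaS. Qed.
Let bSS : bounded_op S. Proof. by apply: continuous_bounded; case: hS. Qed.

Lemma iter_shift N n :
  iter N S (e n) = (b (n + N%:Z) / b n)%:C *: e (n + N%:Z).
Proof.
elim: N => [|N IH]; first by rewrite addr0 divff ?gt_eqF// scale1r.
rewrite iterS IH linearZ /= Se scalerA -rmorphM /= -addn1 PoszD addrA bS.
by congr (_%:C *: _); rewrite mulrAC [w _ * _]mulrC.
Qed.

Lemma coord_shift x n : dot (S x) (e (n + 1)) = (w n)%:C * dot x (e n).
Proof.
have [C C0 HC] := bSS.
apply/eqP; rewrite -subr_eq0; apply/eqP/normc_eq0/eqP.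
rewrite eq_le normc_ge0 andbT; apply/ler_addgt0Pr => d d0; rewrite add0r.
have Cw : 0 < C + w n by rewrite addr_gt0.
have [s [c [us xs]]] := basis_dense he x (divr_gt0 d0 Cw).
set y := \sum_(k <- s) _ in xs.
have hy : dot (S y) (e (n + 1)) = (w n)%:C * dot y (e n).
  rewrite /y linear_sum !dot_sum mulr_sumr; apply: eq_bigr => k _.
  rewrite linearZ /= Se !dotZl !dot_basis// (inj_eq (addIr _)).
  by case: eqVneq => [->|_]; rewrite ?mulr0// !mulr1 mulrC.
have -> : dot (S x) (e (n + 1)) - (w n)%:C * dot x (e n) =
    dot (S (x - y)) (e (n + 1)) - (w n)%:C * dot (x - y) (e n).
  by rewrite linearB !dotBl mulrBr hy subrACA subrr subr0.
have := (@coord_le _ _ _ hdot _ he (S (x - y)) (n + 1)).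
have := (@coord_le _ _ _ hdot _ he (x - y) n).
move=> h1 h2; have h3 := le_trans h2 (HC _).
move: xs; rewrite ltr_pdivlMr// => xs.
apply: (le_trans (ler_normcD _ _)).
rewrite -[normc (- _)]/(rnorm (- _ : R[i]^o)) rnormN -normc_rnorm.
rewrite ComplexField.Normc.normcM normc_real gtr0_norm//.
have := ler_wpM2l (ltW (w0 n)) h1; lra.
Qed.

(** The n-th coordinate of the solution of (S - z) u = 0 with u_0 = 1, which need not
    be square summable. *)
Definition eigen z n : R[i] := (b n)%:C * z ^ (- n).

Lemma eigen_neq0 z n : z != 0 -> eigen z n != 0.
Proof.
move=> z0; rewrite mulf_neq0 ?expfz_neq0//.
by rewrite -(rmorph0 (real_complex R)) (inj_eq (@complexI R)) gt_eqF.
Qed.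

Lemma eigenS z n : z != 0 -> z * eigen z (n + 1) = (w n)%:C * eigen z n.
Proof.
move=> z0; rewrite /eigen bS rmorphM /= opprD expfzDr// -exprnN expr1.
by field.
Qed.

(** Dividing coordinates by those of the formal eigenvector turns S - z into a
    difference operator; the estimate telescopes from n to n + k. *)
Lemma coord_ratio_le z n (k : nat) : z != 0 -> exists2 K, 0 <= K & forall x,
  normc (dot x (e n) / eigen z n - dot x (e (n + k%:Z)) / eigen z (n + k%:Z))
    <= K * rnorm (S x - z *: x).
Proof.
move=> z0; elim: k => [|k [K K0 HK]].
  exists 0 => // x; rewrite addr0 subrr ComplexField.Normc.normc0 mul0r//.
exists (K + normc (z * eigen z (n + k%:Z + 1))^-1) => [|x].
  by rewrite addr_ge0// normc_ge0.
rewrite -addn1 PoszD addrA; set m := n + k%:Z in HK *.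
rewrite -(subrKA (dot x (e m) / eigen z m)) mulrDl.
apply: (le_trans (ler_normcD _ _)); apply: lerD => //.
have -> : dot x (e m) / eigen z m - dot x (e (m + 1)) / eigen z (m + 1) =
    (z * eigen z (m + 1))^-1 * dot (S x - z *: x) (e (m + 1)).
  rewrite dotBl dotZl coord_shift.
  have := eigen_neq0 m z0; have := eigen_neq0 (m + 1) z0 => u1 u0.
  rewrite mulrBr {1}eigenS//; congr (_ - _); last by field; rewrite u1.
  field; rewrite u0 -(rmorph0 (real_complex R)) (inj_eq (@complexI R)) gt_eqF//.
by rewrite ComplexField.Normc.normcM ler_wpM2l ?normc_ge0// coord_le.
Qed.

(** The homogeneous equation has, coordinatewise, a one-dimensional space of solutions;
    here it holds in the limit only, for the preimage f(z) minus more and more bumps. *)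
Lemma coord_ratio_lim z (y : nat -> H) (n1 n2 : int) (a1 a2 : R[i]) : z != 0 ->
  (forall d, 0 < d -> exists M0, forall M, (M0 <= M)%N ->
     rnorm (S (y M) - z *: y M) <= d) ->
  (exists M0, forall M, (M0 <= M)%N -> dot (y M) (e n1) = a1) ->
  (exists M0, forall M, (M0 <= M)%N -> dot (y M) (e n2) = a2) ->
  a1 / eigen z n1 = a2 / eigen z n2.
Proof.
move=> z0; wlog n12 : n1 n2 a1 a2 / exists k : nat, n2 = n1 + k%:Z.
  move=> W hy h1 h2; have [n12|n21] := lerP n1 n2.
    by apply: W => //; exists `|n2 - n1|%N; lia.
  by apply/esym; apply: W => //; exists `|n1 - n2|%N; lia.
have [k ->] := n12; move=> hy [M1 h1] [M2 h2].
have [K K0 HK] := coord_ratio_le n1 k z0.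
apply/eqP; rewrite -subr_eq0; apply/eqP/normc_eq0/eqP.
rewrite eq_le normc_ge0 andbT; apply/ler_addgt0Pr => d d0; rewrite add0r.
have K1 : 0 < K + 1 by rewrite ltr_wpDl.
have [M0 h0] := hy _ (divr_gt0 d0 K1).
pose M := maxn M0 (maxn M1 M2).
rewrite -(h1 M) -?(h2 M) ?leq_max ?leqnn ?orbT//.
apply: (le_trans (HK _)).
have := h0 M; rewrite leq_maxl => /(_ isT); rewrite ler_pdivlMr//.
have := rnorm_ge0 (S (y M) - z *: y M); nra.
Qed.

(** The formal eigenvector truncated to [K, K+p+q) and multiplied by the power of z that
    makes its coordinate at K+p equal to 1. *)
Definition bump (K : int) (p q : nat) (z : R[i]^o) : H :=
  \sum_(i < p + q) (((z : R[i]) ^+ p / z ^+ i) * (b (K + i%:Z) / b (K + p%:Z))%:C)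
    *: e (K + i%:Z).

(** The sum telescopes, as S - z sends each term to z times the difference of two
    consecutive ones.  The two end terms are monomials in 1/z and in z, the shape to which
    [power_series_derivable] applies. *)
Lemma bump_residual K p q (z : R[i]^o) : (z : R[i]) != 0 -> (0 < q)%N ->
  bishop_op S (bump K p q) z =
  (z^-1 : R[i]) ^+ q.-1 *: ((b (K + p%:Z + q%:Z) / b (K + p%:Z))%:C *: e (K + p%:Z + q%:Z))
  - (z : R[i]) ^+ p.+1 *: ((b K / b (K + p%:Z))%:C *: e K).
Proof.
move=> z0 q0; rewrite /bishop_op /bump.
pose t (i : nat) : H :=
  ((z : R[i]) * (z ^+ p / z ^+ i) * (b (K + i%:Z) / b (K + p%:Z))%:C) *: e (K + i%:Z).
transitivity (\sum_(i < p + q) (t i.+1 - t i)).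
  rewrite linear_sum scaler_sumr -sumrB; apply: eq_bigr => i _.
  have KE : K + i.+1%:Z = K + i%:Z + 1 by lia.
  rewrite linearZ /= Se !scalerA /t mulrA KE; congr (_ *: _ - _).
  rewrite bS (rmorphM _ (w _ * _)) (rmorphM _ (w _)) (rmorphM _ (b _)) exprS /=.
  rewrite [in RHS]invfM [X in _ = X * _]mulrCA (mulVKf z0).
  by move: (_ / _) => X; ring.
rewrite -(big_mkord xpredT (fun i => t i.+1 - t i)) telescope_sumr// /t.
rewrite addr0 expr0 divr1 -exprS !scalerA; congr (_ *: _ - _); last first.
  by rewrite PoszD addrA.
rewrite PoszD addrA; congr (_ * _).
case: q q0 => // q _; rewrite exprD exprVn exprS /=; field.
by rewrite ?z0 ?expf_neq0.
Qed.

Lemma bump_coord K p q (z : R[i]^o) n : (z : R[i]) != 0 ->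
  dot (bump K p q z) (e n) =
  if (K <= n) && (n < K + p%:Z + q%:Z)
  then ((z : R[i]) ^ (K + p%:Z - n)) * (b n / b (K + p%:Z))%:C else 0.
Proof.
move=> z0; rewrite /bump dot_sum.
case: ifP => [/andP[Kn nN]|out].
  have [i ni] : exists i : nat, n = K + i%:Z by exists `|n - K|%N; lia.
  have ip : (i < p + q)%N by lia.
  rewrite (bigD1 (Ordinal ip)) //= big1 ?addr0 => [|j ji].
    rewrite dotZl dot_basis// ni eqxx mulr1; congr (_ * _).
    have -> : K + p%:Z - (K + i%:Z) = p%:Z - i%:Z by lia.
    by rewrite expfzDr// -exprnN.
  rewrite dotZl dot_basis// ni; case: eqP => [|_]; last by rewrite mulr0.
  by move=> /addrI [jE]; case/negP: ji; apply/eqP/val_inj.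
apply: big1 => j _; rewrite dotZl dot_basis//.
case: eqP => [jn|_]; last by rewrite mulr0.
by move: out; rewrite -jn; have := ltn_ord j; lia.
Qed.

End Shift.

(** * Analytic functions and compact convergence *)
Section Analytic.
Variables (K : numFieldType) (V : normedModType K).

Lemma derivable_scale_vec (k : K^o -> K) (v : V) (z : K^o) :
  derivable k z 1 -> derivable (fun x => k x *: v) z 1.
Proof.
by move=> /derivable1_diffP dk; apply/derivable1_diffP/differentiableZl.
Qed.

Lemma derivable_bigsum n (f : 'I_n -> K^o -> V) (z : K^o) :
  (forall i, derivable (f i) z 1) -> derivable (fun x => \sum_(i < n) f i x) z 1.
Proof.
move=> df; have -> : (fun x => \sum_(i < n) f i x) = \sum_(i < n) f i.
  by apply/funext => x; rewrite fct_sumE.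
exact: derivable_sum.
Qed.

Lemma derivable_comp_inv (G : K^o -> V) (z : K^o) : z != 0 ->
  derivable G (z^-1 : K) 1 ->
  derivable (fun x : K^o => G (x^-1 : K)) z 1.
Proof.
move=> z0 /derivable1_diffP dG; apply/derivable1_diffP.
exact: (differentiable_comp (differentiable_Rinv z0) dG).
Qed.

Lemma derivable_monomial (p i : nat) (c : K) (z : K^o) : z != 0 ->
  derivable (fun x : K^o => (x : K) ^+ p / (x : K) ^+ i * c) z 1.
Proof.
move=> z0.
have dX q : derivable (fun x : K^o => (x : K) ^+ q) z 1.
  elim: q => [|q IH]; first exact: (derivable_cst (1 : K)).
  rewrite (_ : (fun x : K^o => _) = (id : K^o -> K) * (fun x : K^o => (x : K) ^+ q)).
    by apply: derivableM => //; exact: derivable_id.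
  by apply/funext => x; rewrite exprS.
have dV : derivable (fun x : K^o => ((x : K) ^+ i)^-1) z 1.
  by apply: derivableV; rewrite ?expf_neq0.
exact: (derivableM (derivableM (dX p) dV) (derivable_cst c z 1)).
Qed.

End Analytic.

Section CompactConvergence.
Variables (R : realType) (H : completeNormedModType R[i]).

(** Uniform approximation on U itself is more than what compact convergence asks. *)
Lemma uniform_closure (U : set R[i]^o) (A : set (R[i]^o -> H)) (g : R[i]^o -> H) :
  (forall d, 0 < d -> exists2 h, A h & forall z, U z -> rnorm (g z - h z) <= d) ->
  closure (A : set (compact_convergence H U)) g.
Proof.
move=> approx.
have /choice[h Hh] : forall n : nat, exists h, A h /\
    forall z, U z -> rnorm (g z - h z) <= n.+1%:R^-1.
  move=> n; have [|h Ah gh] := approx n.+1%:R^-1; first by rewrite invr_gt0.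
  by exists h.
have cvgh :
    (h : nat -> compact_convergence H U) @ \oo --> (g : compact_convergence H U).
  apply/fam_cvgP => K [cK KU] B.
  rewrite uniform_nbhs => -[E [entE EB]].
  rewrite -entourage_ballE in entE; have [d /= /ltc_real[d' d'0 ->] dE] := entE.
  exists (Num.truncn (d' / 2)^-1) => // n /= nn.
  apply: EB => z Kz /=; apply: dE => /=; rewrite -ball_normE /= rnormE ltcR.
  have [_ /(_ z (KU z Kz)) h1] := Hh n.
  apply: (le_lt_trans h1); apply: (@le_lt_trans _ _ (d' / 2)); last lra.
  rewrite -[leRHS]invrK lef_pV2 ?posrE ?invr_gt0//; last by rewrite divr_gt0.
  by apply: (le_trans (ltW (truncnS_gt _))); rewrite ler_nat.
move=> B /cvgh[n0 _ Hn0]; exists (h n0); split; first by case: (Hh n0).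
exact: (Hn0 n0 (leqnn n0)).
Qed.

End CompactConvergence.

(** * Peaks contradict property (beta) *)
Section Annulus.
Variable R : realType.
Implicit Types lo hi : R.

Definition annulus lo hi : set R[i]^o := [set z | lo < normc z < hi].

Lemma annulus_open lo hi : open (annulus lo hi).
Proof.
rewrite openE => z /= /andP[lz zh]; apply/nbhs_rnormP.
exists (Num.min (normc z - lo) (hi - normc z)).
  by rewrite lt_min !subr_gt0 lz zh.
move=> y; rewrite lt_min => /andP[h1 h2]; rewrite /annulus /=.
have := ler_normcB z y; have := ler_normcB y z.
rewrite [normc (y - z)](@rnormB _ R[i]^o y z).
rewrite -[rnorm _]/(normc (z - y)) -/(normc _) in h1 h2 *; lra.
Qed.

End Annulus.

Section Peaks.
Variables (R : realType) (H : completeNormedModType R[i]).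
Variables (dot : {dot H for conjC}) (hdot : norm_from_dot dot).
Variables (e : int -> H) (he : orthonormal_basis dot e).
Variables (w : int -> R) (S : {linear H -> H}).
Hypothesis hS : bilateral_weighted_shift S e w.
Hypothesis hbeta : bishop_property_beta S.

Local Notation b := (beta w).

Let w0 n : 0 < w n. Proof. by case: hS. Qed.
Let b0 n : 0 < b n. Proof. exact: beta_gt0. Qed.

Variables (lo hi : R) (K : nat -> int) (p q : nat -> nat).
Let P m := K m + (p m)%:Z.
Let N m := P m + (q m)%:Z.
Hypotheses (lo0 : 0 < lo) (lohi : lo < hi) (q0 : forall m, (0 < q m)%N).
Hypothesis left_drop : forall m, b (K m) * hi ^+ p m <= 2^-1 ^+ m * b (P m).
Hypothesis right_drop : forall m, b (N m) <= 2^-1 ^+ m * lo ^+ q m * b (P m).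
Hypothesis far : forall m, (m <= `|P m|)%N.
Hypothesis isolated : forall i m, i != m -> ~~ ((K m <= P i) && (P i < N m)).

Let U := annulus lo hi.

Let U_neq0 (z : R[i]^o) : U z -> (z : R[i]) != 0.
Proof. by move=> /andP[lz _]; rewrite -normc_gt0 (lt_trans lo0). Qed.

Let bumps M (z : R[i]^o) : H := \sum_(m < M) bump e w (K m) (p m) (q m) z.

Let bumps_analytic M : analytic_on U (bumps M).
Proof.
move=> z Uz; apply: derivable_bigsum => m; apply: derivable_bigsum => i.
by apply: derivable_scale_vec; apply: derivable_monomial; exact: U_neq0.
Qed.

(** The residuals of the bumps are summed into an analytic function; the two families
    of end terms form one power series in 1/z, converging for |z| > lo, and one in z,
    converging for |z| < hi. *)
Let limit_residual : exists g : R[i]^o -> H, analytic_on U g /\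
  forall z M, U z ->
    rnorm (g z - bishop_op S (bumps M) z) <= (lo + hi) * 2^-1 ^+ M / (1 - 2^-1).
Proof.
have h0 : (0 : R) <= 2^-1 by rewrite invr_ge0.
have h1 : (2^-1 : R) < 1 by rewrite invf_lt1 ?ltr1n.
have hi0 : 0 < hi by exact: lt_trans lohi.
pose v m := (b (N m) / b (P m))%:C *: e (N m).
pose v' m := (b (K m) / b (P m))%:C *: e (K m).
have nv m : rnorm (v m) = b (N m) / b (P m).
  by rewrite rnormZ (rnorm_basis hdot he) mulr1 normc_real gtr0_norm// divr_gt0.
have nv' m : rnorm (v' m) = b (K m) / b (P m).
  by rewrite rnormZ (rnorm_basis hdot he) mulr1 normc_real gtr0_norm// divr_gt0.
have [|m|G1 [dG1 tG1]] := @power_series_derivable _ H (fun m => (q m).-1) v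
   lo^-1 lo 2^-1 _ (ltW lo0) h0 h1; first by rewrite invr_gt0.
  rewrite nv exprVn mulrAC ler_pdivrMr// ler_pdivrMr ?exprn_gt0//.
  apply: (le_trans (right_drop m)); have := q0 m; case: (q m) => // k _ /=.
  by rewrite exprS le_eqVlt; apply/orP; left; apply/eqP; ring.
have [|G2 [dG2 tG2]] := @power_series_derivable _ H (fun m => (p m).+1) v'
   hi hi 2^-1 hi0 (ltW hi0) h0 h1.
  move=> m; rewrite nv' mulrAC ler_pdivrMr// exprS.
  have := ler_wpM2l (ltW hi0) (left_drop m); lra.
have invU (z : R[i]^o) : U z -> normc (z^-1 : R[i]) < lo^-1.
  move=> Uz; have /andP[lz _] := Uz; rewrite ComplexField.Normc.normcV.
  by rewrite ltf_pV2 ?posrE// (lt_trans lo0).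
exists (fun z => G1 ((z : R[i])^-1) - G2 z); split=> [z Uz|z M Uz].
  apply: derivableB.
    by apply: derivable_comp_inv; [exact: U_neq0|apply: dG1; exact: invU].
  by apply: dG2; case/andP: Uz.
have resid : bishop_op S (bumps M) z =
    \sum_(m < M) (z^-1 : R[i]) ^+ (q m).-1 *: v m
    - \sum_(m < M) (z : R[i]) ^+ (p m).+1 *: v' m.
  rewrite -sumrB /bishop_op /bumps linear_sum scaler_sumr -sumrB.
  by apply: eq_bigr => m _; exact: (bump_residual hS _ _ (U_neq0 Uz) (q0 m)).
rewrite resid subrACA; apply: (le_trans (rnorm_distD _ _)).
rewrite mulrDl mulrDl; apply: lerD; first by apply: tG1; exact: invU.
by apply: tG2; case/andP: Uz.
Qed.

(** Here closed range is used.  With f the analytic preimage of the limit and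
    y_M = f(z) - sum of the first M bumps, (S - z) y_M tends to 0, while the coordinate
    of y_M at P_m is eventually f_{P_m} - 1, as no other bump meets P_m.  So
    f_{P_m} - 1 = h u_{P_m} with h independent of m, and f_{P_m} tends to 0. *)
Let radius_estimate (c : R) : lo < c < hi -> exists2 eta, 0 < eta &
  exists m0, forall m, (m0 <= m)%N ->
    2^-1 <= eta * (b (P m) * c ^ (- P m)) <= 2.
Proof.
move=> /andP[lc ch].
have [g [ag tg]] := limit_residual.
have [_ closed_range] := @hbeta U (@annulus_open _ lo hi).
have c0 : 0 < c by exact: lt_trans lc.
have hi0 : 0 < hi by exact: lt_trans lohi.
have tail_small d : 0 < d -> exists M0, forall M, (M0 <= M)%N ->
    (lo + hi) * 2^-1 ^+ M / (1 - 2^-1) <= d.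
  move=> d0; have [||n0 Hn0] := @geometric_small R 2^-1 ((lo + hi) / (1 - 2^-1)) d _ _ d0.
  - by rewrite invr_gt0.
  - by rewrite invf_lt1 ?ltr1n.
  by exists n0 => n /Hn0; rewrite mulrAC.
have [] := closed_range g ag.
  apply: uniform_closure => d d0; have [M0 HM] := tail_small d d0.
  exists (bishop_op S (bumps M0)); first by exists (bumps M0); split.
  by move=> z Uz; apply: (le_trans (tg z M0 Uz)); exact: HM.
move=> f [af gf].
pose z : R[i]^o := c%:C.
have nz : normc (z : R[i]) = c by rewrite normc_real gtr0_norm.
have Uz : U z by rewrite /U /annulus /mkset nz lc.
have z0 := U_neq0 Uz.
pose a m := dot (f z) (e (P m)).
pose y M := f z - bumps M z.
have resid d : 0 < d -> exists M0, forall M, (M0 <= M)%N ->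
    rnorm (S (y M) - (z : R[i]) *: y M) <= d.
  move=> d0; have [M0 HM] := tail_small d d0; exists M0 => M MM.
  apply: le_trans (HM M MM); apply: le_trans (tg z M Uz).
  by rewrite gf// /y /bishop_op linearB scalerBr subrACA.
have coordy m : exists M0, forall M, (M0 <= M)%N -> dot (y M) (e (P m)) = a m - 1.
  exists m.+1 => M mM; rewrite /y dotBl; congr (_ - _).
  rewrite /bumps dot_sum (bigD1 (Ordinal mM)) //= big1 ?addr0 => [|j jm].
    rewrite (bump_coord he) // -/(P m) subrr expr0z mul1r divff ?gt_eqF//.
    rewrite -/(N m) ifT//; apply/andP; split; first by rewrite /P; lia.
    by have := q0 m; rewrite /N; lia.
  rewrite (bump_coord he) // -/(P j) -/(N j) (negPf (isolated _))//.
  by apply: contra jm => /eqP mj; apply/eqP/val_inj.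
pose h := (a 0%N - 1) / eigen w z (P 0%N).
have ha m : a m - 1 = h * eigen w z (P m).
  have := coord_ratio_lim hdot he hS z0 resid (coordy m) (coordy 0%N).
  by rewrite -/h => <-; rewrite divfK// (eigen_neq0 hS).
have nu m : normc (eigen w z (P m)) = b (P m) * c ^ (- P m).
  rewrite /eigen ComplexField.Normc.normcM normc_real gtr0_norm//; congr (_ * _).
  by rewrite normcXz nz.
have half0 : (0 : R) < 2^-1 by rewrite invr_gt0.
have [m0 Hm0] := coord_vanish hdot he (f z) half0.
have est m : (m0 <= m)%N -> 2^-1 <= normc h * (b (P m) * c ^ (- P m)) <= 2.
  move=> mm; have am : normc (a m) < 2^-1.
    by rewrite Hm0//; exact: leq_trans (far m).
  have := ler_normcB 1 (a m); have := ler_normcD (a m) (- 1).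
  have -> : normc (- 1 : R[i]) = 1.
    exact: (etrans (@rnormN _ R[i]^o 1) (ComplexField.Normc.normc1 R)).
  have -> : normc (1 - a m) = normc (a m - 1) by exact: (@rnormB _ R[i]^o 1 (a m)).
  rewrite ha.
  rewrite ComplexField.Normc.normcM nu ComplexField.Normc.normc1; lra.
exists (normc h); last by exists m0.
rewrite lt_neqAle normc_ge0 andbT eq_sym; apply/eqP => h0.
by have := est m0 (leqnn _); rewrite h0 mul0r; lra.
Qed.

(** Two radii c < c' cannot both satisfy [radius_estimate], since the ratio of the two
    estimated quantities is (c'/c)^{P_m} up to a constant and |P_m| is unbounded. *)
Lemma no_peak_family : False.
Proof.
pose c := (2 * lo + hi) / 3; pose c' := (lo + 2 * hi) / 3.
have [|eta eta0 [m1 H1]] := @radius_estimate c.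
  by apply/andP; split; rewrite /c; have := lohi; lra.
have [|eta' eta'0 [m2 H2]] := @radius_estimate c'.
  by apply/andP; split; rewrite /c'; have := lohi; lra.
have c0 : 0 < c by rewrite /c; have := lo0; have := lohi; lra.
have cc' : c < c' by rewrite /c /c'; have := lohi; lra.
have c'0 : 0 < c' by exact: lt_trans cc'.
pose t := c' / c.
have t1 : 1 < t by rewrite /t ltr_pdivlMr// mul1r.
have t0 : 0 < t by exact: lt_trans t1.
have [n0 Hn0] := @expr_unbounded R t (4 * (eta / eta' + eta' / eta) + 1) t1.
pose m := maxn n0 (maxn m1 m2).
have := H1 m; rewrite !leq_max leqnn orbT => /(_ isT)/andP[A1 A2].
have := H2 m; rewrite !leq_max leqnn !orbT => /(_ isT)/andP[B1 B2].
have ratioE (x y : R) (n : int) : 0 < x -> 0 < y ->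
    x ^ (- n) = y ^ (- n) * (y / x) ^ n.
  move=> x0 y0; rewrite expfzMl exprz_inv mulrA -expfzDr ?gt_eqF//.
  by rewrite addNr expr0z mul1r.
have tE : c ^ (- P m) = c' ^ (- P m) * t ^ (P m) by exact: ratioE.
have big : 4 * (eta / eta' + eta' / eta) + 1 <= t ^+ `|P m|.
  by apply: Hn0; rewrite (leq_trans _ (far m))// leq_max leqnn.
have X0 : 0 < b (P m) * c' ^ (- P m) by rewrite mulr_gt0// exprz_gt0.
have small : t ^+ `|P m| <= 4 * (eta / eta' + eta' / eta).
  rewrite tE [b _ * (_ * _)]mulrA in A1 A2.
  move: (b (P m) * c' ^ (- P m)) X0 A1 A2 B1 B2 => X X0.
  have e1 : 0 < eta / eta' by rewrite divr_gt0.
  have e2 : 0 < eta' / eta by rewrite divr_gt0.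
  rewrite mulrDr; case: (P m) => k.
    rewrite -exprnP /= => A1 A2 B1 B2.
    apply: (@le_trans _ _ (4 * (eta' / eta))); last lra.
    rewrite mulrA ler_pdivlMr// -(ler_pM2r X0). 
    lra.
  rewrite NegzE -exprnN => A1 A2 B1 B2.
  apply: (@le_trans _ _ (4 * (eta / eta'))); last lra.
  move: A1 A2; rewrite abszN absz_nat.
  set Y := t ^+ k.+1; have Y0 : 0 < Y by rewrite exprn_gt0.
  move=> A1 _; rewrite mulrA ler_pdivlMr// in A1.
  rewrite mulrA ler_pdivlMr//; nra.
by have := le_trans big small; lra.
Qed.

End Peaks.

(** * From windows of growth and decay to peaks *)
Section Windows.
Variable R : realType.
Implicit Types (d : nat -> R) (a b C : R).

Lemma not_upper_growth d b J C : (forall n, 0 < d n) -> 0 < b ->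
  ~ upper_growth d b -> 0 < C ->
  exists i n, (J <= i)%N /\ C * b ^+ n * d i < d (i + n)%N.
Proof.
move=> d0 bp nu C0; apply: contrapT => nex; apply: nu.
apply: (@upper_growth_tail _ _ _ J) => //; exists C => // i n.
rewrite leNgt; apply/negP => lt; apply: nex; exists (J + i)%N, n.
by rewrite leq_addr -addnA.
Qed.

Lemma not_lower_growth d a J C : (forall n, 0 < d n) -> 0 < a ->
  ~ lower_growth d a -> 0 < C ->
  exists i n, (J <= i)%N /\ d (i + n)%N < C * a ^+ n * d i.
Proof.
move=> d0 a0 nl C0; apply: contrapT => nex; apply: nl.
apply: (@lower_growth_tail _ _ _ J) => //; exists C => // i n.
rewrite leNgt; apply/negP => lt; apply: nex; exists (J + i)%N, n.
by rewrite leq_addr -addnA.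
Qed.

Variable x : int -> R.
Hypothesis x0 : forall n, 0 < x n.

(** For lo <= |z| <= hi, the sequence x_n |z|^(-n) is T times larger at K+p than at the
    ends K and K+p+q of the window; the left end is worst at |z| = hi, the right end
    at |z| = lo. *)
Definition peak lo hi T (K : int) (p q : nat) :=
  [/\ (0 < q)%N, T * x K * hi ^+ p <= x (K + p%:Z) &
      T * x (K + p%:Z + q%:Z) <= lo ^+ q * x (K + p%:Z)].

Lemma peak_anti lo hi T T' K p q : 0 <= T' -> T' <= T ->
  peak lo hi T K p q -> peak lo hi T' K p q.
Proof.
move=> T0 TT [q0 h1 h2].
have hx (u : R) : 0 <= u -> T' * u <= T * u by move=> u0; rewrite ler_wpM2r.
split=> //; last by apply: le_trans h2; rewrite hx// ltW.
have [hi0|hi0] := lerP 0 (hi ^+ p).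
  by apply: le_trans h1; rewrite -!mulrA hx// mulr_ge0// ltW.
by apply: le_trans (ltW (x0 _)); rewrite mulr_ge0_le0 ?(ltW hi0)// mulr_ge0// ltW.
Qed.

(** For a radius c let y_j = x_j c^(-j), and let m = k+p+r.  The value at k+p is high
    compared with k for all radii up to b, that at m compared with m+n for all radii
    down to a.  At the intermediate radius c, if y_m >= T y_k then m is a peak of the
    whole window for radii in [a, c].  Otherwise y_m < T y_k, which is far below y_{k+p},
    and k+p is a peak of [k, m) for radii in [c, b]; the factor T^2 on the first window
    pays for this comparison. *)
Lemma peak_of_windows a c b T (k : int) (p r n : nat) :
  0 < a -> a < c -> c < b -> 1 < T ->
  T ^+ 2 * b ^+ p * x k < x (k + p%:Z) ->
  T * x (k + p%:Z + r%:Z + n%:Z) < a ^+ n * x (k + p%:Z + r%:Z) ->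
  exists p' q' : nat, (p' + q' <= p + r + n)%N /\
    (peak a c T k p' q' \/ peak c b T k p' q').
Proof.
move=> a0 ac cb T1 up down.
have c0 : 0 < c by exact: lt_trans ac.
have T0 : 0 < T by exact: lt_trans T1.
have xk := x0 k.
have [hm|hm] := lerP (T * x k * c ^+ (p + r)) (x (k + p%:Z + r%:Z)).
  exists (p + r)%N, n; split=> //; left; rewrite /peak PoszD addrA; split=> //.
    case: n down => // /=; rewrite addr0 expr0 mul1r.
    by have := x0 (k + p%:Z + r%:Z); nra.
  exact: ltW.
exists p, r; split; first by rewrite leq_addr.
right.
have cbp : c ^+ p <= b ^+ p by rewrite ler_expr// ltW.
have cp : 0 < c ^+ p by rewrite exprn_gt0.
have cr : 0 < c ^+ r by rewrite exprn_gt0.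
have bp : 0 < b ^+ p by exact: lt_le_trans cbp.
have up1 : T * x k * b ^+ p < x (k + p%:Z).
  apply: lt_trans up; rewrite expr2 -!mulrA ltr_pM2l// mulrA mulrC -mulrA.
  by have := mulr_gt0 bp xk; nra.
split; last 2 first.
- exact: ltW.
- rewrite exprD in hm; apply/ltW.
  apply: (@lt_trans _ _ (T * (T * x k * (c ^+ p * c ^+ r)))); first by rewrite ltr_pM2l.
  apply: (@le_lt_trans _ _ (T ^+ 2 * b ^+ p * x k * c ^+ r)); last first.
    by rewrite [ltRHS]mulrC ltr_pM2r.
  have -> : T * (T * x k * (c ^+ p * c ^+ r)) = T ^+ 2 * c ^+ p * x k * c ^+ r by ring.
  by rewrite ler_pM2r// ler_pM2r// ler_pM2l// exprn_gt0.
case: r hm {down cr} => //; rewrite addr0 addn0 => hm; exfalso.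
have : T * x k * c ^+ p <= T * x k * b ^+ p by rewrite ler_pM2l// mulr_gt0.
lra.
Qed.

(** Windows that go off to infinity on a prescribed side: each one can then be chosen
    disjoint from the previous ones. *)
Definition beyond (s : bool) (J : nat) (K N : int) :=
  if s then J%:Z <= K else N <= - J%:Z.

Lemma beyond_anti s J J' K N N' : (J' <= J)%N -> N' <= N ->
  beyond s J K N -> beyond s J' K N'.
Proof. by rewrite /beyond; case: s; lia. Qed.

(** The annulus obtained from [peak_of_windows] is one of two; one of them occurs for
    arbitrarily large J, and decreasing J only weakens the conclusion. *)
Lemma peaks_of_windows s a b : 0 < a -> a < b ->
  (forall J, exists (k : int) (p r n : nat),
    [/\ beyond s J k (k + p%:Z + r%:Z + n%:Z),
        (2 ^+ J.+1) ^+ 2 * b ^+ p * x k < x (k + p%:Z) &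
        2 ^+ J.+1 * x (k + p%:Z + r%:Z + n%:Z) < a ^+ n * x (k + p%:Z + r%:Z)]) ->
  exists lo hi, [/\ 0 < lo, lo < hi & forall J, exists (K : int) (p q : nat),
    beyond s J K (K + p%:Z + q%:Z) /\ peak lo hi (2 ^+ J.+1) K p q].
Proof.
move=> a0 ab win; pose c := (a + b) / 2.
have ac : a < c by rewrite /c; lra.
have cb : c < b by rewrite /c; lra.
pose Q lo hi J := exists (K : int) (p q : nat),
  beyond s J K (K + p%:Z + q%:Z) /\ peak lo hi (2 ^+ J.+1) K p q.
have Qanti lo hi J J' : (J' <= J)%N -> Q lo hi J -> Q lo hi J'.
  move=> JJ [K [p [q [bey [q0 h1 h2]]]]]; exists K, p, q; split.
    exact: beyond_anti bey.
  apply: (peak_anti _ _ (And3 q0 h1 h2)); first exact: exprn_ge0.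
  by rewrite ler_eXn2l ?ltnS// ltr1n.
have QQ J : Q a c J \/ Q c b J.
  have [k [p [r [n [bey up down]]]]] := win J.
  have T1 : 1 < 2 ^+ J.+1 :> R by rewrite exprn_egt1// ltr1n.
  have [p' [q' [le []pk]]] := peak_of_windows a0 ac cb T1 up down.
    by left; exists k, p', q'; split=> //; apply: beyond_anti bey => //; lia.
  by right; exists k, p', q'; split=> //; apply: beyond_anti bey => //; lia.
have [all1|] := pselect (forall J, Q a c J); first by exists a, c.
move=> /existsNP[J0 nQ]; exists c, b; split=> //; first exact: lt_trans ac.
move=> J; have [h|h] := QQ (maxn J J0).
  by case: nQ; apply: Qanti h; rewrite leq_maxr.
by apply: Qanti h; rewrite leq_maxl.
Qed.

(** The windows are chosen one after the other, each beyond the absolute values of the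
    ends of the previous ones. *)
Lemma peak_family s lo hi : (forall J, exists (K : int) (p q : nat),
    beyond s J K (K + p%:Z + q%:Z) /\ peak lo hi (2 ^+ J.+1) K p q) ->
  exists (K : nat -> int) (p q : nat -> nat),
    let P m := K m + (p m)%:Z in let N m := P m + (q m)%:Z in
    [/\ forall m, peak lo hi (2 ^+ m) (K m) (p m) (q m),
        forall m, (m <= `|P m|)%N &
        forall i m : nat, i != m -> ~~ ((K m <= P i) && (P i < N m))].
Proof.
move=> /choice[K /choice[p /choice[q H]]].
pose N J := K J + (p J)%:Z + (q J)%:Z.
pose next J := (J + `|K J| + `|N J|).+1%N.
pose J m := iter m next 0%N.
have Jm m : (m <= J m)%N by elim: m => // m; rewrite /J iterS /next -/(J m); lia.
have Jlt i m : (i < m)%N -> (`|K (J i)| + `|N (J i)| <= J m)%N.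
  elim: m => // m IH; rewrite ltnS leq_eqVlt => /orP[/eqP->|/IH h].
    by rewrite /J iterS /next -/(J m); lia.
  by apply: (leq_trans h); rewrite /J iterS /next -/(J m); lia.
exists (K \o J), (p \o J), (q \o J) => /=; split=> [m|m|i m im].
- have [_ [q0 h1 h2]] := H (J m).
  apply: (peak_anti _ _ (And3 q0 h1 h2)); first exact: exprn_ge0.
  by rewrite ler_eXn2l ?(leqW (Jm m))// ltr1n.
- have [bey [q0 _ _]] := H (J m); have := Jm m; move: bey; rewrite /beyond.
  by case: s {H} => h1 h2; lia.
- have [bi [qi _ _]] := H (J i); have [bm [qm _ _]] := H (J m).
  move: bi bm; rewrite /beyond; move: im; rewrite neq_ltn => /orP[/Jlt|/Jlt];
    rewrite /N; case: (s) => h1 h2 h3; lia.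
Qed.

End Windows.

(** * One growth rate on each half-line *)
Lemma cross_cancel (V : zmodType) (x y z t : V) :
  (x - y) + ((z + y) - (x + t)) = z - t.
Proof. by rewrite [z + y]addrC opprD [X in _ + X]addrACA -[x - y]opprB addKr. Qed.

Section Dichotomy.
Variables (R : realType) (H : completeNormedModType R[i]).
Variables (dot : {dot H for conjC}) (hdot : norm_from_dot dot).
Variables (e : int -> H) (he : orthonormal_basis dot e).
Variables (w : int -> R) (S : {linear H -> H}).
Hypothesis hS : bilateral_weighted_shift S e w.
Hypothesis hbeta : bishop_property_beta S.

Local Notation b := (beta w).

Let w0 n : 0 < w n. Proof. by case: hS. Qed.
Let b0 n : 0 < b n. Proof. exact: beta_gt0. Qed.
Let bS n : b (n + 1) = w n * b n. Proof. exact: betaS. Qed.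

Let natS (n : nat) : n.+1%:Z = n%:Z + 1. Proof. by rewrite -addn1 PoszD. Qed.
Let natNS (n : nat) : - n.+1%:Z + 1 = - n%:Z. Proof. by rewrite natS opprD subrK. Qed.

Let Sbe n : S ((b n)%:C *: e n) = (b (n + 1))%:C *: e (n + 1).
Proof.
have [_ _ _ Se] := hS.
by rewrite linearZ /= Se scalerA -rmorphM /= bS mulrC.
Qed.

Definition growth_right (n : nat) : R := b n%:Z.

(** The inverse makes growth on the left half-line read in the direction of the shift:
    growth_left (i + n) / growth_left i is the product of the weights over
    [-(i+n), -i). *)
Definition growth_left (n : nat) : R := (b (- n%:Z))^-1.

Lemma growth_right_gt0 n : 0 < growth_right n. Proof. exact: b0. Qed.
Lemma growth_left_gt0 n : 0 < growth_left n. Proof. by rewrite invr_gt0 b0. Qed.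

Lemma weight_growth_bounded : exists2 M, 0 < M &
  upper_growth growth_right M /\ upper_growth growth_left M.
Proof.
have [_ [M HM] _ _] := hS; exists M; first exact: lt_le_trans (w0 0) (HM 0).
have M0 : 0 <= M by exact: le_trans (ltW (w0 0)) (HM 0).
have up (k : int) n : b (k + n%:Z) <= M ^+ n * b k.
  elim: n => [|n IH]; first by rewrite addr0 expr0 mul1r.
  rewrite -addn1 PoszD addrA bS addn1 exprS -mulrA.
  by apply: ler_pM => //; exact: ltW.
split; exists 1 => // i n; rewrite mul1r; first exact: (up i%:Z n).
rewrite /growth_left -[leLHS]mul1r ler_pdivrMr// mulrAC ler_pdivlMr// mul1r.
have := up (- (i + n)%N%:Z) n; rewrite (_ : - (i + n)%N%:Z + n%:Z = - i%:Z)//.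
lia.
Qed.

Lemma windows_contradiction s a c : 0 < a -> a < c ->
  (forall J, exists (k : int) (p r n : nat),
    [/\ beyond s J k (k + p%:Z + r%:Z + n%:Z),
        (2 ^+ J.+1) ^+ 2 * c ^+ p * b k < b (k + p%:Z) &
        2 ^+ J.+1 * b (k + p%:Z + r%:Z + n%:Z) < a ^+ n * b (k + p%:Z + r%:Z)]) ->
  False.
Proof.
move=> a0 ac /(peaks_of_windows b0 a0 ac)[lo [hi [lo0 lohi /(peak_family b0)]]].
move=> [K [p [q [pk far iso]]]].
have T0 m : (0 : R) < 2 ^+ m by rewrite exprn_gt0.
apply: (no_peak_family hdot he hS hbeta lo0 lohi _ _ _ far iso).
- by move=> m; case: (pk m).
- move=> m; case: (pk m) => _ h _.
  by rewrite exprVn ler_pdivlMl// mulrA.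
- move=> m; case: (pk m) => _ _ h.
  by rewrite exprVn -mulrA ler_pdivlMl.
Qed.

(** If both bounds fail, a window of fast growth far to the right is followed by a window
    of slow growth even further. *)
Lemma growth_right_dichotomy a c : 0 < a -> a < c ->
  upper_growth growth_right c \/ lower_growth growth_right a.
Proof.
move=> a0 ac; have c0 : 0 < c by exact: lt_trans ac.
apply: contrapT => /not_orP[nu nl].
apply: (windows_contradiction (s := true) a0 ac) => J.
have T0 : (0 : R) < 2 ^+ J.+1 by rewrite exprn_gt0.
have [i [p [Ji up]]] := not_upper_growth J growth_right_gt0 c0 nu (exprn_gt0 2 T0).
have Tv : (0 : R) < (2 ^+ J.+1)^-1 by rewrite invr_gt0.
have [m [n [im down]]] := not_lower_growth (i + p) growth_right_gt0 a0 nl Tv.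
exists i%:Z, p, (m - (i + p))%N, n.
have mE : i%:Z + p%:Z + (m - (i + p))%N%:Z = m%:Z by lia.
rewrite mE; split; [by rewrite /beyond; lia|exact: up|].
by move: down; rewrite -mulrA ltr_pdivlMl.
Qed.

(** Indices now increase towards -oo, so the window of slow growth is chosen first and
    the window of fast growth further to the left. *)
Lemma growth_left_dichotomy a c : 0 < a -> a < c ->
  upper_growth growth_left c \/ lower_growth growth_left a.
Proof.
move=> a0 ac; have c0 : 0 < c by exact: lt_trans ac.
apply: contrapT => /not_orP[nu nl].
apply: (windows_contradiction (s := false) a0 ac) => J.
have T0 : (0 : R) < 2 ^+ J.+1 by rewrite exprn_gt0.
have Tv : (0 : R) < (2 ^+ J.+1)^-1 by rewrite invr_gt0.
have [i [n [Ji down]]] := not_lower_growth J growth_left_gt0 a0 nl Tv.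
have [m [p [im up]]] := not_upper_growth (i + n) growth_left_gt0 c0 nu (exprn_gt0 2 T0).
exists (- (m + p)%N%:Z), p, (m - (i + n))%N, n.
have -> : - (m + p)%N%:Z + p%:Z = - m%:Z by lia.
have -> : - m%:Z + (m - (i + n))%N%:Z = - (i + n)%N%:Z by lia.
have -> : - (i + n)%N%:Z + n%:Z = - i%:Z by lia.
split; first by rewrite /beyond; lia.
  by move: up; rewrite /growth_left ltr_pdivrMr// [ltRHS]mulrC ltr_pdivlMr.
move: down; rewrite /growth_left ltr_pdivlMr// [ltLHS]mulrC ltr_pdivrMr//.
by rewrite -mulrA ltr_pdivlMl.
Qed.

(** If rr < rl, the formal eigenvector is square summable for rr < |z| < rl and depends
    analytically on z, being a power series in 1/z plus a power series in z; this
    contradicts injectivity on an annulus. *)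
Lemma growth_left_le_right rl rr : 0 <= rr ->
  (forall c, rr < c -> upper_growth growth_right c) ->
  (forall a, 0 < a < rl -> lower_growth growth_left a) -> rl <= rr.
Proof.
move=> rr0 upr lol; rewrite leNgt; apply/negP => lt.
(* five equal steps: rr < c < lo < hi < a < rl *)
pose u := (rl - rr) / 5.
have u0 : 0 < u by rewrite /u; lra.
pose c := rr + u; pose lo := rr + 2 * u; pose hi := rr + 3 * u; pose a := rr + 4 * u.
have c0 : 0 < c by rewrite /c; lra.
have lo0 : 0 < lo by rewrite /lo; lra.
have hi0 : 0 < hi by rewrite /hi; lra.
have a0 : 0 < a by rewrite /a; lra.
have [|C C0 HC] := upr c; first by rewrite /c; lra.
have [|D D0 HD] := lol a; first by apply/andP; split=> //; rewrite /a /u; lra.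
have {}HC m : b m%:Z <= C * c ^+ m.
  by have := HC 0%N m; rewrite /growth_right beta0 mulr1.
have {}HD m : b (- m%:Z) <= D^-1 * a^-1 ^+ m.
  have := HD 0%N m; rewrite /growth_left beta0 invr1 mulr1 add0n => h.
  rewrite exprVn -invfM -[leLHS]invrK lef_pV2 ?posrE ?invr_gt0// mulr_gt0// exprn_gt0//.
pose t1 := c / lo; pose t2 := hi / a.
have t10 : 0 < t1 by rewrite divr_gt0.
have t11 : t1 < 1 by rewrite ltr_pdivrMr// mul1r /c /lo; lra.
have t20 : 0 < t2 by rewrite divr_gt0.
have t21 : t2 < 1 by rewrite ltr_pdivrMr// mul1r /a /hi; lra.
have D'0 : 0 <= D^-1 by rewrite invr_ge0 ltW.
pose v1 m := (b m%:Z)%:C *: e m%:Z.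
pose v2 m := (b (- m%:Z))%:C *: e (- m%:Z).
have nv1 m : rnorm (v1 m) = b m%:Z.
  by rewrite rnormZ (rnorm_basis hdot he) mulr1 normc_real gtr0_norm.
have nv2 m : rnorm (v2 m) = b (- m%:Z).
  by rewrite rnormZ (rnorm_basis hdot he) mulr1 normc_real gtr0_norm.
have bnd1 m : rnorm (v1 m) * lo^-1 ^+ m <= C * t1 ^+ m.
  by rewrite nv1 expr_div_n mulrA exprVn ler_pM2r// invr_gt0 exprn_gt0.
have bnd2 m : rnorm (v2 m) * hi ^+ m <= D^-1 * t2 ^+ m.
  rewrite nv2 expr_div_n mulrA [_ / a ^+ m]mulrAC ler_pM2r ?exprn_gt0// -exprVn.
  exact: HD.
have lov : 0 < lo^-1 by rewrite invr_gt0.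
have [G1 [dG1 tG1]] := power_series_derivable lov (ltW C0) (ltW t10) t11 bnd1.
have bnd2' m : rnorm (v2 m.+1) * hi ^+ m.+1 <= D^-1 * t2 ^+ m.
  apply: (le_trans (bnd2 m.+1)); rewrite exprSr mulrA ler_piMr//; last exact: ltW.
  by rewrite mulr_ge0// exprn_ge0// ltW.
have [G2 [dG2 tG2]] := @power_series_derivable _ _ succn (fun m => v2 m.+1)
  _ _ _ hi0 D'0 (ltW t20) t21 bnd2'.
have U_neq0 (z : R[i]^o) : annulus lo hi z -> (z : R[i]) != 0.
  by move=> /andP[lz _]; rewrite -normc_gt0 (lt_trans lo0).
have invU (z : R[i]^o) : annulus lo hi z -> normc (z^-1 : R[i]) < lo^-1.
  move=> /andP[lz _]; rewrite ComplexField.Normc.normcV.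
  by rewrite ltf_pV2 ?posrE// (lt_trans lo0).
pose f (z : R[i]^o) := G1 ((z : R[i])^-1) + G2 z.
have af : analytic_on (annulus lo hi) f.
  move=> z Uz; apply: derivableD.
    by apply: derivable_comp_inv; [exact: U_neq0|apply: dG1; exact: invU].
  by apply: dG2; case/andP: Uz.
pose fM M (z : R[i]) :=
  \sum_(m < M) (z^-1) ^+ m *: v1 m + \sum_(m < M) z ^+ m.+1 *: v2 m.+1.
have tf z M : annulus lo hi z ->
    rnorm (f z - fM M z) <= C * t1 ^+ M / (1 - t1) + D^-1 * t2 ^+ M / (1 - t2).
  move=> Uz; rewrite /f /fM opprD addrACA; apply: (le_trans (rnormD _ _)).
  by apply: lerD; [apply: tG1; exact: invU|apply: tG2; case/andP: Uz].
(* the truncation to [-M, M) has residual only at its two ends *)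
have resM M (z : R[i]) : z != 0 ->
    S (fM M z) - z *: fM M z = z *: (z^-1 ^+ M *: v1 M - z ^+ M *: v2 M).
  move=> z0; elim: M => [|M IH].
    rewrite /fM !big_ord0 addr0 linear0 scaler0 subr0 !expr0 !scale1r.
    by rewrite [X in z *: X](_ : _ = 0) ?scaler0//; exact: subrr.
  have -> : fM M.+1 z = fM M z + (z^-1 ^+ M *: v1 M + z ^+ M.+1 *: v2 M.+1).
    by rewrite /fM !big_ord_recr /= addrACA.
  have Sv1 : S (v1 M) = v1 M.+1.
    by rewrite /v1 Sbe natS.
  have Sv2 : S (v2 M.+1) = v2 M.
    by rewrite /v2 Sbe natNS.
  have St : S (z^-1 ^+ M *: v1 M + z ^+ M.+1 *: v2 M.+1) =
      z^-1 ^+ M *: v1 M.+1 + z ^+ M.+1 *: v2 M.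
    by rewrite linearD; congr (_ + _); rewrite linearZ /= ?Sv1 ?Sv2.
  rewrite linearD scalerDr opprD addrACA IH St.
  rewrite !scalerBr !scalerDr !scalerA -![z * z ^+ _]exprS.
  have -> : z * z^-1 ^+ M.+1 = z^-1 ^+ M by rewrite exprS mulrA divff// mul1r.
  exact: cross_cancel.
have eigenf z : annulus lo hi z -> bishop_op S f z = 0.
  move=> Uz; have z0 := U_neq0 z Uz; have /andP[lz zh] := Uz.
  have [B B0 HB] : bounded_op (fun x : H => S x + (- (z : R[i])) *: x).
    by apply: bounded_add; [apply: continuous_bounded; case: hS|exact: bounded_scale].
  apply/rnorm_eq0/eqP; rewrite eq_le rnorm_ge0 andbT.
  apply/ler_addgt0Pr => d d0; rewrite add0r.
  have d2 : 0 < d / 2 by rewrite divr_gt0.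
  have [n1 Hn1] := geometric_small (B * (C / (1 - t1)) + normc z * C) t10 t11 d2.
  have [n2 Hn2] := geometric_small (B * (D^-1 / (1 - t2)) + normc z * D^-1) t20 t21 d2.
  pose M := maxn n1 n2.
  have := Hn1 M; rewrite leq_maxl => /(_ isT) h1.
  have := Hn2 M; rewrite leq_maxr => /(_ isT) h2.
  have -> : bishop_op S f z = (S (f z - fM M z) + (- (z : R[i])) *: (f z - fM M z))
      + (S (fM M z) - (z : R[i]) *: fM M z).
    rewrite /bishop_op scaleNr linearB scalerBr subrACA.
    by rewrite subrK.
  apply: (le_trans (rnormD _ _)).
  have e1 : rnorm (S (fM M z) - (z : R[i]) *: fM M z)
      <= normc z * (C * t1 ^+ M + D^-1 * t2 ^+ M).
    rewrite resM// rnormZ ler_wpM2l ?normc_ge0//.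
    apply: (le_trans (rnorm_distD _ _)).
    rewrite (rnormZ _ (v1 M)) (rnormZ _ (v2 M)) !normcX; apply: lerD.
      apply: le_trans (bnd1 M); rewrite mulrC ler_wpM2l ?rnorm_ge0// ler_expr ?normc_ge0//.
      exact/ltW/invU.
    apply: le_trans (bnd2 M); rewrite mulrC ler_wpM2l ?rnorm_ge0//.
    by rewrite ler_expr ?normc_ge0// ltW.
  have e2 := le_trans (HB _) (ler_wpM2l (ltW B0) (tf z M Uz)).
  have := lerD e2 e1; lra.
pose z : R[i]^o := ((lo + hi) / 2)%:C.
have nz : normc (z : R[i]) = (lo + hi) / 2.
  by rewrite normc_real gtr0_norm// divr_gt0// addr_gt0.
have Uz : annulus lo hi z.
  by rewrite /annulus /mkset nz; apply/andP; split; rewrite /lo /hi; lra.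
have [inj _] := @hbeta (annulus lo hi) (@annulus_open _ lo hi).
have a0f : analytic_on (annulus lo hi) (fun=> 0 : H) by move=> ? _; exact: derivable_cst.
have fz0 : f z = 0.
  apply: (inj f (fun=> 0) af a0f) => // x Ux.
  by rewrite eigenf// /bishop_op linear0 scaler0 subr0.
(* f is not 0, its coordinate at 0 being 1 *)
have coord1 M : dot (fM M.+1 z) (e 0) = 1.
  rewrite /fM dotDl !dot_sum (bigD1 ord0) //= !big1 ?addr0 => [| |m m0].
  - by rewrite expr0 scale1r /v1 dotZl (dot_basis he) beta0 mulr1.
  - by move=> m _; rewrite /v2 !dotZl (dot_basis he) (_ : _ == _ = false) ?mulr0//; lia.
  - rewrite /v1 !dotZl (dot_basis he) (_ : _ == _ = false) ?mulr0//.
    by apply/negbTE; apply: contra m0 => /eqP[h]; apply/eqP/val_inj.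
have h4 : 0 < (4^-1 : R) by rewrite invr_gt0.
have [n1 Hn1] := geometric_small (C / (1 - t1)) t10 t11 h4.
have [n2 Hn2] := geometric_small (D^-1 / (1 - t2)) t20 t21 h4.
pose M := (maxn n1 n2).+1.
have h1 := Hn1 M (leqW (leq_maxl _ _)).
have h2 := Hn2 M (leqW (leq_maxr _ _)).
have := coord_le hdot he (fM M z) 0; rewrite coord1 ComplexField.Normc.normc1.
have := tf z M Uz; rewrite fz0 sub0r rnormN; lra.
Qed.

End Dichotomy.

(** * Subexponential sequences and growth on the whole line *)
Section Subexponential.
Variable R : realType.
Implicit Types (d s : nat -> R) (t r C D : R).

Definition subexponential s :=
  (forall t, 1 < t -> exists C, forall n, s n <= C * t ^+ n) /\
  (forall t, 0 < t < 1 -> exists2 C, 0 < C & forall n, C * t ^+ n <= s n).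

Lemma geometric_rate_le s t t' C D : 0 < C -> 0 < t' ->
  (forall n, C * t ^+ n <= s n) -> (forall n, s n <= D * t' ^+ n) -> t <= t'.
Proof.
move=> C0 t'0 lo up; rewrite leNgt; apply/negP => tt.
have [n0 Hn0] := geometric_dominates (D / C + 1) t'0 tt.
have := Hn0 n0 (leqnn _); have := le_trans (lo n0) (up n0).
have : 0 < t' ^+ n0 by rewrite exprn_gt0.
move=> h1 h2 h3; have := ler_wpM2l (ltW C0) h3.
rewrite mulrA mulrDr mulr1 mulrCA divff ?gt_eqF// mulr1; nra.
Qed.

(** [endpoint_dichotomy] leaves exponential growth or decay, both excluded here. *)
Lemma subexponential_endpoint s D : 0 < D -> (forall n, 0 < s n) ->
  subexponential s ->
  ~ forall k n, (k <= n)%N -> \sum_(k <= j < n) s j <= D * (s k + s n).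
Proof.
move=> D0 s0 [up lo] H.
have [[t [C [t1 C0 HC]]]|[t [C [t0 t1 HC]]]] := endpoint_dichotomy D0 s0 H.
  have [|E HE] := up ((1 + t) / 2); first lra.
  have h : 0 < (1 + t) / 2 by lra.
  have := geometric_rate_le C0 h HC HE; lra.
have [|E E0 HE] := lo ((1 + t) / 2); first by apply/andP; split; lra.
have := geometric_rate_le E0 t0 HE HC; lra.
Qed.

Lemma subexponentialV s : (forall n, 0 < s n) -> subexponential s ->
  subexponential (fun n => (s n)^-1).
Proof.
move=> s0 [up lo]; split=> t.
  move=> t1; have t0 : 0 < t by exact: lt_trans t1.
  have [|C C0 HC] := lo t^-1; first by rewrite invr_gt0 t0 invf_lt1.
  exists C^-1 => n; rewrite -[t in t ^+ n]invrK [_ ^+ n]exprVn -invfM.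
  by rewrite lef_pV2 ?posrE// mulr_gt0// exprn_gt0// invr_gt0.
move=> /andP[t0 t1]; have [|C HC] := up t^-1; first by rewrite invf_gt1.
have C0 : 0 < C by have := HC 0%N; rewrite expr0 mulr1; exact: lt_le_trans.
exists C^-1; first by rewrite invr_gt0.
move=> n; rewrite -[t in t ^+ n]invrK [_ ^+ n]exprVn -invfM.
by rewrite lef_pV2 ?posrE// mulr_gt0// exprn_gt0// invr_gt0.
Qed.

Lemma subexponential_ratio d r : (forall n, 0 < d n) -> 0 < r ->
  (forall c, r < c -> upper_growth d c) ->
  (forall a, 0 < a < r -> lower_growth d a) ->
  subexponential (fun n => (d n / r ^+ n) ^+ 2).
Proof.
move=> d0 r0 up lo; split=> t.
  move=> t1; have t0 : 0 < t by exact: lt_trans t1.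
  have st : 1 < Num.sqrt t by rewrite -sqrtr1 ltr_sqrt.
  have [|C C0 HC] := up (r * Num.sqrt t); first by rewrite ltr_pMr.
  exists ((C * d 0%N) ^+ 2) => n.
  have := HC 0%N n; rewrite add0n exprMn => h.
  have h1 : d n / r ^+ n <= C * d 0%N * Num.sqrt t ^+ n.
    rewrite ler_pdivrMr ?exprn_gt0//; lra.
  have -> : t ^+ n = (Num.sqrt t ^+ n) ^+ 2 by rewrite exprAC sqr_sqrtr// ltW.
  rewrite -exprMn.
  by apply: ler_expr => //; rewrite divr_ge0 ?exprn_ge0// ltW.
move=> /andP[t0 t1]; have st0 : 0 < Num.sqrt t by rewrite sqrtr_gt0.
have st : Num.sqrt t < 1 by rewrite -sqrtr1 ltr_sqrt.
have [|C C0 HC] := lo (r * Num.sqrt t); first by rewrite mulr_gt0//= gtr_pMr.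
exists ((C * d 0%N) ^+ 2) => [|n]; first by rewrite exprn_gt0// mulr_gt0.
have := HC 0%N n; rewrite add0n exprMn => h.
have h1 : C * d 0%N * Num.sqrt t ^+ n <= d n / r ^+ n.
  rewrite ler_pdivlMr ?exprn_gt0//; lra.
have -> : t ^+ n = (Num.sqrt t ^+ n) ^+ 2 by rewrite exprAC sqr_sqrtr// ltW.
rewrite -exprMn.
by apply: ler_expr => //; rewrite !mulr_ge0 ?exprn_ge0// ltW.
Qed.

(** A window containing 0 is cut at 0, and the two constants are multiplied. *)
Lemma upper_growth_line (x : int -> R) c : (forall n, 0 < x n) -> 0 < c ->
  upper_growth (fun n => x n%:Z) c -> upper_growth (fun n => (x (- n%:Z))^-1) c ->
  exists2 C, 0 < C & forall (k : int) (n : nat), x (k + n%:Z) <= C * c ^+ n * x k.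
Proof.
move=> x0 c0 [C C0 HC] [D D0 HD].
have C1 : 1 <= C.
  by have := HC 0%N 0%N; rewrite addn0 expr0 mulr1 ler_pMl.
have D1 : 1 <= D.
  by have := HD 0%N 0%N; rewrite addn0 expr0 mulr1 ler_pMl// invr_gt0.
have {}HD i n : x (- i%:Z) <= D * c ^+ n * x (- (i + n)%N%:Z).
  by have := HD i n; rewrite -[leLHS]mul1r ler_pdivrMr// mulrAC ler_pdivlMr// mul1r.
have right (k n : nat) : x (k%:Z + n%:Z) <= C * D * c ^+ n * x k%:Z.
  have h := HC k n; apply: (le_trans h); rewrite ler_pM2r// ler_pM2r ?exprn_gt0//.
  by rewrite ler_peMr// ltW.
have left (k n m : nat) : k = (m + n)%N -> x (- m%:Z) <= C * D * c ^+ n * x (- k%:Z).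
  move=> ->; apply: (le_trans (HD m n)); rewrite ler_pM2r// ler_pM2r ?exprn_gt0//.
  by rewrite ler_peMl// ltW.
exists (C * D) => [|k n]; first exact: mulr_gt0.
have [k0|k0] := lerP 0 k.
  have -> : k = `|k|%N%:Z by lia.
  exact: right.
have kE : k = - `|k|%N%:Z by lia.
have [kn|kn] := leqP n `|k|%N.
  have -> : k + n%:Z = - (`|k| - n)%N%:Z by lia.
  by rewrite [in leRHS]kE; apply: left; rewrite subnK.
have -> : k + n%:Z = (n - `|k|)%N%:Z by lia.
have h1 := HC 0%N (n - `|k|)%N; rewrite add0n in h1.
have h2 := HD 0%N `|k|%N; rewrite add0n oppr0 -kE in h2.
apply: (le_trans h1); rewrite -[in c ^+ n](subnK (ltnW kn)) exprD.
have cp : 0 <= C * c ^+ (n - `|k|) by rewrite mulr_ge0 ?exprn_ge0 ?ltW.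
have := ler_wpM2l cp h2; lra.
Qed.

End Subexponential.

(** * Invertibility off the closed annulus *)
Section Spectrum.
Variables (R : realType) (H : completeNormedModType R[i]).
Variables (dot : {dot H for conjC}) (hdot : norm_from_dot dot).
Variables (e : int -> H) (he : orthonormal_basis dot e).
Variables (w : int -> R) (S : {linear H -> H}).
Hypothesis hS : bilateral_weighted_shift S e w.
Implicit Types (x y : H) (z : R[i]) (k : int).

Local Notation b := (beta w).

Let w0 n : 0 < w n. Proof. by case: hS. Qed.
Let b0 n : 0 < b n. Proof. exact: beta_gt0. Qed.
Let bS n : b (n + 1) = w n * b n. Proof. exact: betaS. Qed.
Let Se n : S (e n) = (w n)%:C *: e (n + 1). Proof. by case: hS. Qed.
Let bSS : bounded_op S. Proof. by apply: continuous_bounded; case: hS. Qed.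

Let iterS_linear N : linear (iter N S).
Proof.
by elim: N => [//|N IH] a x y; rewrite !iterS IH linearP.
Qed.

Lemma iter_shift_sum N (s : seq int) (c : int -> R[i]) : uniq s ->
  rnorm (iter N S (\sum_(n <- s) c n *: e n)) ^+ 2 =
  \sum_(n <- s) (normc (c n) * (b (n + N%:Z) / b n)) ^+ 2.
Proof.
move=> us.
pose lN := GRing.isLinear.Build _ _ _ _ (iter N S) (iterS_linear N).
pose A : {linear H -> H} := HB.pack (iter N S) lN.
rewrite -[iter N S]/(A : H -> H) linear_sum.
pose g m := c (m - N%:Z) * (b m / b (m - N%:Z))%:C.
transitivity (rnorm (\sum_(m <- [seq n + N%:Z | n <- s]) g m *: e m) ^+ 2).
  congr (rnorm _ ^+ 2); rewrite big_map; apply: eq_bigr => n _.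
  rewrite linearZ /= /g addrK -scalerA; congr (_ *: _).
  exact: (iter_shift hS N n).
rewrite (rnorm_sum_basis hdot he) ?map_inj_uniq//; last exact: addIr.
rewrite big_map; apply: eq_bigr => n _; rewrite /g addrK.
by rewrite ComplexField.Normc.normcM normc_real gtr0_norm// divr_gt0.
Qed.

Lemma iter_shift_upper N M : 0 < M -> (forall k, b (k + N%:Z) <= M * b k) ->
  forall x, rnorm (iter N S x) <= M * rnorm x.
Proof.
move=> M0 HM x.
pose lN := GRing.isLinear.Build _ _ _ _ (iter N S) (iterS_linear N).
pose A : {linear H -> H} := HB.pack (iter N S) lN.
have linB : linear (fun x : H => M%:C *: x).
  by move=> a u v; rewrite scalerDr !scalerA mulrC.
pose lB := GRing.isLinear.Build _ _ _ _ (fun x : H => M%:C *: x) linB.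
pose B : {linear H -> H} := HB.pack (fun x : H => M%:C *: x) lB.
have nB y : rnorm (B y) = M * rnorm y by rewrite /= rnormZ normc_real gtr0_norm.
rewrite -nB; apply: (dense_rnorm_le he (A := A)); first exact: bounded_iter.
  exact: bounded_scale.
move=> s c us; rewrite nB -(@ler_pXn2r _ 2%N)// ?nnegrE ?mulr_ge0 ?rnorm_ge0 ?(ltW M0)//.
rewrite exprMn (rnorm_sum_basis hdot he)// [rnorm _ ^+ 2](iter_shift_sum N c us) mulr_sumr.
apply: ler_sum => n _; rewrite -exprMn; apply: ler_expr.
  by rewrite mulr_ge0 ?normc_ge0// divr_ge0 ?ltW.
by rewrite mulrC ler_wpM2r ?normc_ge0// ler_pdivrMr.
Qed.

Lemma iter_shift_lower N M : 0 < M -> (forall k, M * b k <= b (k + N%:Z)) ->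
  forall x, M * rnorm x <= rnorm (iter N S x).
Proof.
move=> M0 HM x.
pose lN := GRing.isLinear.Build _ _ _ _ (iter N S) (iterS_linear N).
pose A : {linear H -> H} := HB.pack (iter N S) lN.
have linB : linear (fun x : H => M%:C *: x).
  by move=> a u v; rewrite scalerDr !scalerA mulrC.
pose lB := GRing.isLinear.Build _ _ _ _ (fun x : H => M%:C *: x) linB.
pose B : {linear H -> H} := HB.pack (fun x : H => M%:C *: x) lB.
have nB y : rnorm (B y) = M * rnorm y by rewrite /= rnormZ normc_real gtr0_norm.
rewrite -nB; apply: (dense_rnorm_le he (B := A)); first exact: bounded_scale.
  exact: bounded_iter.
move=> s c us; rewrite nB -(@ler_pXn2r _ 2%N)// ?nnegrE ?mulr_ge0 ?rnorm_ge0 ?(ltW M0)//.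
rewrite exprMn (rnorm_sum_basis hdot he)// [rnorm _ ^+ 2](iter_shift_sum N c us) mulr_sumr.
apply: ler_sum => n _; rewrite -exprMn; apply: ler_expr.
  by rewrite mulr_ge0 ?normc_ge0// ltW.
by rewrite mulrC ler_wpM2l ?normc_ge0// ler_pdivlMr.
Qed.

(** S^N - z^N factors through S - z; the induction avoids writing the cofactor. *)
Lemma iter_residual z N : exists2 C, 0 < C & forall x,
  rnorm (iter N S x - z ^+ N *: x) <= C * rnorm (S x - z *: x).
Proof.
elim: N => [|N [C C0 HC]].
  by exists 1 => // x; rewrite expr0 scale1r subrr rnorm0 mul1r rnorm_ge0.
have [D D0 HD] := bounded_iter N bSS.
exists (D + normc z * C); first by rewrite ltr_pwDl// mulr_ge0 ?normc_ge0// ltW.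
move=> x.
pose lN := GRing.isLinear.Build _ _ _ _ (iter N S) (iterS_linear N).
pose A : {linear H -> H} := HB.pack (iter N S) lN.
have AE u v : iter N S (u - z *: v) = iter N S u - z *: iter N S v.
  by rewrite -[iter N S]/(A : H -> H) linearB linearZ.
have -> : iter N.+1 S x - z ^+ N.+1 *: x =
    iter N S (S x - z *: x) + z *: (iter N S x - z ^+ N *: x).
  by rewrite AE iterSr scalerBr scalerA -exprS subrKA.
apply: (le_trans (rnormD _ _)); rewrite mulrDl; apply: lerD => //.
by rewrite rnormZ -mulrA ler_wpM2l ?normc_ge0.
Qed.

(** A bounded operator that is bounded below with dense range is invertible, and density
    need only be tested on the basis. *)
Lemma shift_invertible z (delta : R) : 0 < delta ->
  (forall x, delta * rnorm x <= rnorm (S x - z *: x)) ->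
  (forall k (d : R), 0 < d -> exists x, rnorm (e k - (S x - z *: x)) < d) ->
  ~ spectrum S z.
Proof.
move=> delta0 below dense; apply; apply: bounded_below_inverse delta0 below _.
- move=> a x y; rewrite linearP scalerDr scalerA mulrC -scalerA opprD addrACA.
  by rewrite scalerBr.
- have [B B0 HB] : bounded_op (fun x : H => S x + (- z) *: x).
    by apply: bounded_add => //; exact: bounded_scale.
  by exists B => // x; rewrite -scaleNr.
- move=> y d d0; have d2 : 0 < d / 2 by rewrite divr_gt0.
  have [s [c [_ ys]]] := basis_dense he y d2.
  suff [x Hx] : exists x, rnorm (\sum_(n <- s) c n *: e n - (S x - z *: x)) < d / 2.
    exists x; rewrite -(subrKA (\sum_(n <- s) c n *: e n)).
    apply: (le_lt_trans (rnormD _ _)); lra.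
  elim: s (d / 2) d2 {ys} => [|n s IH] t t0.
    by exists 0; rewrite big_nil linear0 scaler0 !subr0 rnorm0.
  have t2 : 0 < t / 2 by rewrite divr_gt0.
  have [x Hx] := IH _ t2.
  have c1 : 0 < normc (c n) + 1 by rewrite ltr_wpDl ?normc_ge0.
  have [u Hu] := dense n (t / 2 / (normc (c n) + 1)) (divr_gt0 t2 c1).
  exists (c n *: u + x); rewrite big_cons.
  have -> : c n *: e n + \sum_(j <- s) c j *: e j -
      (S (c n *: u + x) - z *: (c n *: u + x)) =
      c n *: (e n - (S u - z *: u)) +
      (\sum_(j <- s) c j *: e j - (S x - z *: x)).
    rewrite linearP !scalerBr scalerDr !scalerA [z * _]mulrC.
    rewrite [in RHS]addrACA; congr (_ + _); rewrite -opprD; congr (- _).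
    by rewrite opprD addrACA.
  apply: (le_lt_trans (rnormD _ _)); rewrite rnormZ.
  move: Hu; rewrite ltr_pdivlMr// => Hu.
  have := rnorm_ge0 (e n - (S u - z *: u)); lra.
Qed.

(** Some power satisfies |S^N x| <= q |x| with q < |z|^N, so S^N - z^N, and hence S - z, is
    bounded below.  Partial sums of the Neumann series in S/z approximate e_k in the
    range. *)
Lemma not_spectrum_outside z (C c : R) : 0 < C -> 0 < c -> c < normc z ->
  (forall k (n : nat), b (k + n%:Z) <= C * c ^+ n * b k) -> ~ spectrum S z.
Proof.
move=> C0 c0 cz HC.
have nz0 : 0 < normc z by exact: lt_trans cz.
have z0 : z != 0 by rewrite -normc_gt0.
pose c1 := (c + normc z) / 2.
have cc1 : c < c1 by rewrite /c1; lra.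
have c1z : c1 < normc z by rewrite /c1; lra.
have [N0 HN0] := geometric_dominates C c0 cc1.
pose N := N0.+1; have HN : C * c ^+ N <= c1 ^+ N by exact: HN0.
have lt1 : C * c ^+ N < normc z ^+ N.
  by apply: (le_lt_trans HN); rewrite ltrXn2r ?nnegrE ?normc_ge0// /c1; lra.
have [D D0 HD] := iter_residual z N.
apply: (@shift_invertible _ ((normc z ^+ N - C * c ^+ N) / D)).
- by rewrite divr_gt0// subr_gt0.
- move=> x; rewrite mulrAC ler_pdivrMr// [leRHS]mulrC; apply: le_trans (HD x).
  have CN : 0 < C * c ^+ N by rewrite mulr_gt0// exprn_gt0.
  have h1 := iter_shift_upper CN (fun k => HC k N) x.
  have h2 : rnorm (z ^+ N *: x) <= rnorm (iter N S x - z ^+ N *: x) + rnorm (iter N S x).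
    have := rnorm_distD (iter N S x) (iter N S x - z ^+ N *: x).
    by rewrite subKr addrC.
  move: h2; rewrite rnormZ normcX; lra.
- move=> k d d0.
  have ex n : exists x, S x - z *: x = e k - z^-1 ^+ n *: iter n S (e k).
    elim: n => [|n [x Hx]].
      by exists 0; rewrite expr0 scale1r subrr linear0 scaler0 subr0.
    exists (x - z^-1 ^+ n.+1 *: iter n S (e k)).
    have zE : z * z^-1 ^+ n.+1 = z^-1 ^+ n by rewrite exprS mulrA divff// mul1r.
    by rewrite linearB scalerBr subrACA Hx [S (_ *: _)]linearZ /= scalerA zE opprB subrKA.
  have t0 : 0 < c / normc z by rewrite divr_gt0.
  have t1 : c / normc z < 1 by rewrite ltr_pdivrMr// mul1r.
  have d2 : 0 < d / 2 by rewrite divr_gt0.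
  have [n0 Hn0] := geometric_small C t0 t1 d2.
  have [x Hx] := ex n0; exists x; rewrite Hx subKr rnormZ (iter_shift hS) rnormZ.
  rewrite (rnorm_basis hdot he) mulr1 normcX ComplexField.Normc.normcV normc_real.
  rewrite gtr0_norm ?divr_gt0//.
  apply: (@le_lt_trans _ _ (d / 2)); last lra.
  apply: le_trans (Hn0 n0 (leqnn _)).
  rewrite expr_div_n exprVn [leLHS]mulrC [leRHS]mulrA ler_pM2r ?invr_gt0 ?exprn_gt0//.
  by rewrite ler_pdivrMr.
Qed.

(** Dual to [not_spectrum_outside]: some power satisfies |S^N x| >= q |x| with
    q > |z|^N, and e_k is approximated through backward orbits of the shift. *)
Lemma not_spectrum_inside z (C c : R) : 0 < C -> normc z < c ->
  (forall k (n : nat), C * c ^+ n * b k <= b (k + n%:Z)) -> ~ spectrum S z.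
Proof.
move=> C0 zc HC; have nz0 := normc_ge0 z.
have c0 : 0 < c by exact: le_lt_trans zc.
(* c1 is positive even when z = 0 *)
pose c1 := (c + normc z) / 2.
have c10 : 0 < c1 by rewrite /c1; lra.
have cc1 : c1 < c by rewrite /c1; lra.
have c1z : normc z < c1 by rewrite /c1; lra.
have [N0 HN0] := geometric_dominates C^-1 c10 cc1.
pose N := N0.+1; have HN : C^-1 * c1 ^+ N <= c ^+ N by exact: HN0.
have lt1 : normc z ^+ N < C * c ^+ N.
  rewrite -ltr_pdivrMl//; apply: lt_le_trans HN.
  by rewrite ltr_pM2l ?invr_gt0// ltrXn2r ?nnegrE// ltW.
have [D D0 HD] := iter_residual z N.
apply: (@shift_invertible _ ((C * c ^+ N - normc z ^+ N) / D)).
- by rewrite divr_gt0// subr_gt0.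
- move=> x; rewrite mulrAC ler_pdivrMr// [leRHS]mulrC; apply: le_trans (HD x).
  have CN : 0 < C * c ^+ N by rewrite mulr_gt0// exprn_gt0.
  have h1 := iter_shift_lower CN (fun k => HC k N) x.
  have h2 : rnorm (iter N S x) <= rnorm (iter N S x - z ^+ N *: x) + rnorm (z ^+ N *: x).
    by rewrite -[in leLHS](subrK (z ^+ N *: x) (iter N S x)) rnormD.
  move: h2; rewrite rnormZ normcX; lra.
- move=> k d d0.
  have ex (n : nat) : exists x, S x - z *: x =
      e k - (z ^+ n * (b (k - n%:Z) / b k)%:C) *: e (k - n%:Z).
    elim: n => [|n [x Hx]].
      exists 0; rewrite expr0 subr0 divff ?gt_eqF// mulr1 scale1r subrr.
      by rewrite linear0 scaler0 subr0.
    exists (x + (z ^+ n * (b (k - n.+1%:Z) / b k)%:C) *: e (k - n.+1%:Z)).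
    have kE : k - n%:Z = (k - n.+1%:Z) + 1 by lia.
    move: (k - n.+1%:Z) kE => m kE.
    rewrite linearD scalerDr opprD addrACA Hx [S (_ *: _)]linearZ /= Se !scalerA -kE.
    have -> : z ^+ n * (b m / b k)%:C * (w m)%:C = z ^+ n * (b (k - n%:Z) / b k)%:C.
      by rewrite kE bS -mulrA -rmorphM /=; congr (_ * _%:C); ring.
    by rewrite addrA subrK mulrA -exprS.
  have t0 : 0 < c1 / c by rewrite divr_gt0.
  have t1 : c1 / c < 1 by rewrite ltr_pdivrMr// mul1r.
  have d2 : 0 < d / 2 by rewrite divr_gt0.
  have [n0 Hn0] := geometric_small C^-1 t0 t1 d2.
  have [x Hx] := ex n0; exists x; rewrite Hx subKr rnormZ.
  rewrite (rnorm_basis hdot he) mulr1 ComplexField.Normc.normcM normcX normc_real.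
  rewrite gtr0_norm ?divr_gt0//.
  apply: (@le_lt_trans _ _ (d / 2)); last lra.
  apply: le_trans (Hn0 n0 (leqnn _)).
  have h := HC (k - n0%:Z) n0; rewrite subrK in h.
  rewrite expr_div_n [leRHS]mulrCA; apply: ler_pM.
  - exact: exprn_ge0.
  - by apply: divr_ge0; exact: ltW.
  - by apply: ler_expr => //; exact: ltW.
  - rewrite -invfM ler_pdivrMr// mulrC ler_pdivlMr ?mulr_gt0 ?exprn_gt0//.
    by rewrite mulrC.
Qed.

End Spectrum.

(** * The two rates belong to the spectrum *)
Section Boundary.
Variables (R : realType) (H : completeNormedModType R[i]).
Variables (dot : {dot H for conjC}) (hdot : norm_from_dot dot).
Variables (e : int -> H) (he : orthonormal_basis dot e).
Variables (w : int -> R) (S : {linear H -> H}).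
Hypothesis hS : bilateral_weighted_shift S e w.

Local Notation b := (beta w).

Let w0 n : 0 < w n. Proof. by case: hS. Qed.
Let b0 n : 0 < b n. Proof. exact: beta_gt0. Qed.
Let bS n : b (n + 1) = w n * b n. Proof. exact: betaS. Qed.
Let Se n : S (e n) = (w n)%:C *: e (n + 1). Proof. by case: hS. Qed.
Let Sce (a : R[i]) n : S (a *: e n) = (a * (w n)%:C) *: e (n + 1).
Proof. by rewrite linearZ /= Se scalerA. Qed.
Let natS (n : nat) : n.+1%:Z = n%:Z + 1. Proof. by rewrite -addn1 PoszD. Qed.
Let natNS (n : nat) : - n.+1%:Z + 1 = - n%:Z. Proof. by rewrite natS opprD subrK. Qed.

Lemma not_bounded_below_spectrum (z : R[i]) :
  ~ (exists2 C, 0 < C & forall x, rnorm x <= C * rnorm (S x - z *: x)) ->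
  spectrum S z.
Proof.
move=> nbb [T [cT TS _]]; apply: nbb.
have [C C0 HC] := continuous_bounded cT; exists C => // x.
by rewrite -{1}(TS x).
Qed.

Lemma rnorm_sum_inj (iota : nat -> int) (c : nat -> R) k m : injective iota ->
  rnorm (\sum_(k <= j < k + m) (c j)%:C *: e (iota j)) ^+ 2 =
  \sum_(k <= j < k + m) c j ^+ 2.
Proof.
move=> inj; elim: m => [|m IH]; first by rewrite addn0 !big_geq// rnorm0 expr0n.
rewrite addnS !big_nat_recr ?leq_addr//= (pythagoras hdot he) ?IH.
  by rewrite normc_real real_normK// num_real.
rewrite dot_sum big_seq big1// => j; rewrite mem_index_iota => /andP[_ jm].
by rewrite dotZl (dot_basis he) (inj_eq inj) (ltn_eqF jm) mulr0.
Qed.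

(** The vector x is a truncation of the formal eigenvector to a window, whose residual sits
    at its two ends.  The extra term c_k^2 leaves room for truncations to (k, n], which
    are the natural ones when the window is read leftwards. *)
Lemma approx_eigen_spectrum (z : R[i]) (r : R) (c : nat -> R) : 0 < r ->
  (forall n, 0 < c n) -> subexponential (fun n => c n ^+ 2) ->
  (forall k n, (k <= n)%N -> exists2 x : H,
     \sum_(k <= j < n) c j ^+ 2 <= rnorm x ^+ 2 + c k ^+ 2 &
     rnorm (S x - z *: x) <= r * (c k + c n)) ->
  spectrum S z.
Proof.
move=> r0 c0 sub approx; apply: not_bounded_below_spectrum => -[C C0 HC].
have D0 : 0 < 2 * (C * r) ^+ 2 + 1.
  by rewrite ltr_wpDl// mulr_ge0// exprn_ge0// mulr_ge0 ?ltW.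
apply: (subexponential_endpoint D0 _ sub) => [n|k n kn]; first by rewrite exprn_gt0.
have [x h1 h2] := approx k n kn; apply: (le_trans h1).
have h3 : rnorm x <= C * r * (c k + c n).
  by apply: (le_trans (HC x)); rewrite -mulrA ler_wpM2l// ltW.
have h4 : rnorm x ^+ 2 <= (C * r * (c k + c n)) ^+ 2 by rewrite ler_expr// rnorm_ge0.
have h5 : (c k + c n) ^+ 2 <= 2 * (c k ^+ 2 + c n ^+ 2).
  by have := sqr_ge0 (c k - c n); rewrite !expr2; lra.
have h6 := ler_wpM2l (sqr_ge0 (C * r)) h5.
have := sqr_ge0 (c n); rewrite exprMn in h4; lra.
Qed.

(** At rate 0 there is no formal eigenvector to truncate; instead, invertibility of S bounds
    the weights away from 0. *)
Lemma no_superexponential_decay (d : nat -> R) q : (forall n, 0 < d n) -> 0 < q ->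
  (forall c, 0 < c -> upper_growth d c) -> ~ (forall n, q * d n <= d n.+1).
Proof.
move=> d0 q0 up grow; have q2 : 0 < q / 2 by rewrite divr_gt0.
have [C C0 HC] := up _ q2.
have lo n : d 0%N * q ^+ n <= d n.
  elim: n => [|n IH]; first by rewrite expr0 mulr1.
  apply: le_trans (grow n); by rewrite exprS mulrCA ler_wpM2l ?(ltW q0).
have hi n : d n <= C * d 0%N * (q / 2) ^+ n.
  by have := HC 0%N n; rewrite add0n; lra.
have := geometric_rate_le (d0 0%N) q2 lo hi; lra.
Qed.

Let weights_below C : 0 < C ->
  (forall x : H, rnorm x <= C * rnorm (S x - (0 : R)%:C *: x)) ->
  forall n, C^-1 <= w n.
Proof.
move=> C0 HC n; have := HC (e n).
rewrite scale0r subr0 Se rnormZ !(rnorm_basis hdot he) mulr1 normc_real.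
by rewrite gtr0_norm// -ler_pdivrMl// mulr1.
Qed.

Lemma right_rate_spectrum r : 0 <= r ->
  (forall c, r < c -> upper_growth (growth_right w) c) ->
  (forall a, 0 < a < r -> lower_growth (growth_right w) a) ->
  spectrum S r%:C.
Proof.
rewrite le_eqVlt => /predU1P[<-|r0] up lo.
  apply: not_bounded_below_spectrum => -[C C0 HC].
  apply: (no_superexponential_decay (growth_right_gt0 hS) _ up (q := C^-1)).
    by rewrite invr_gt0.
  move=> n; rewrite /growth_right natS bS ler_wpM2r ?(ltW (b0 _))//.
  exact: weights_below.
pose c j := b j%:Z / r ^+ j.
have c0 j : 0 < c j by rewrite divr_gt0// exprn_gt0.
apply: (approx_eigen_spectrum r0 c0).
  exact: (subexponential_ratio (growth_right_gt0 hS) r0 up lo).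
move=> k n /subnKC <-; move: (n - k)%N => m.
exists (\sum_(k <= j < k + m) (c j)%:C *: e j%:Z).
  by rewrite rnorm_sum_inj ?lerDl ?sqr_ge0// => i j [].
pose U j := (c j)%:C *: e j%:Z.
have SU j : S (U j) = r%:C *: U j.+1.
  rewrite /U Sce scalerA natS -!rmorphM; congr (_%:C *: _).
  have rj : r ^+ j != 0 by rewrite expf_neq0// gt_eqF.
  have rn0 : r != 0 by rewrite gt_eqF.
  by rewrite /c natS bS exprS; move: (r ^+ j) rj => v v0; field; rewrite rn0 v0.
have -> : S (\sum_(k <= j < k + m) U j) - r%:C *: (\sum_(k <= j < k + m) U j) =
    r%:C *: (U (k + m)%N - U k).
  rewrite linear_sum scaler_sumr -sumrB -telescope_sumr ?leq_addr// scaler_sumr.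
  by apply: eq_bigr => j _; rewrite SU scalerBr.
rewrite rnormZ normc_real gtr0_norm// ler_wpM2l ?(ltW r0)//.
apply: (le_trans (rnorm_distD _ _)).
by rewrite !rnormZ !(rnorm_basis hdot he) !normc_real !gtr0_norm// !mulr1 addrC.
Qed.

Lemma left_rate_spectrum r : 0 <= r ->
  (forall c, r < c -> upper_growth (growth_left w) c) ->
  (forall a, 0 < a < r -> lower_growth (growth_left w) a) ->
  spectrum S r%:C.
Proof.
rewrite le_eqVlt => /predU1P[<-|r0] up lo.
  apply: not_bounded_below_spectrum => -[C C0 HC].
  apply: (no_superexponential_decay (growth_left_gt0 hS) _ up (q := C^-1)).
    by rewrite invr_gt0.
  move=> n; rewrite /growth_left -natNS bS invfM.
  have := weights_below C0 HC (- n.+1%:Z) => h.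
  rewrite mulrA; apply: ler_piMl; first by rewrite invr_ge0; exact: (ltW (b0 _)).
  by rewrite ler_pdivrMr// mul1r.
pose c j := b (- j%:Z) * r ^+ j.
have c0 j : 0 < c j by rewrite mulr_gt0// exprn_gt0.
apply: (approx_eigen_spectrum r0 c0).
  have sub := subexponential_ratio (growth_left_gt0 hS) r0 up lo.
  have sub0 n : 0 < (growth_left w n / r ^+ n) ^+ 2.
    have := growth_left_gt0 hS n => gn.
    by apply: exprn_gt0; apply: divr_gt0 => //; exact: exprn_gt0.
  have := subexponentialV sub0 sub; congr subexponential.
  by apply/funext => n; rewrite -exprVn invfM invrK /growth_left invrK.
move=> k n /subnKC <-; move: (n - k)%N => m.
pose U j := (c j)%:C *: e (- j%:Z).
exists (\sum_(k.+1 <= j < k.+1 + m) U j).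
  rewrite rnorm_sum_inj => [|i j /oppr_inj []//].
  have <- : \sum_(k <= j < (k + m).+1) c j ^+ 2 =
      \sum_(k.+1 <= j < k.+1 + m) c j ^+ 2 + c k ^+ 2.
    by rewrite big_ltn ?ltnS ?leq_addr// addrC addSn.
  by rewrite big_nat_recr ?leq_addr//= lerDl sqr_ge0.
have SU j : S (U j.+1) = r%:C *: U j.
  rewrite /U Sce scalerA natNS -!rmorphM; congr (_%:C *: _).
  rewrite /c -(natNS j) bS exprS; ring.
have -> : S (\sum_(k.+1 <= j < k.+1 + m) U j) -
    r%:C *: (\sum_(k.+1 <= j < k.+1 + m) U j) = r%:C *: (U k - U (k + m)%N).
  rewrite addSn !big_add1 /= linear_sum scaler_sumr -sumrB -opprB.
  rewrite -telescope_sumr ?leq_addr// -sumrN scaler_sumr.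
  by apply: eq_bigr => j _; rewrite SU -scalerBr opprB.
rewrite rnormZ normc_real gtr0_norm// ler_wpM2l ?(ltW r0)//.
apply: (le_trans (rnorm_distD _ _)).
by rewrite !rnormZ !(rnorm_basis hdot he) !normc_real !gtr0_norm// !mulr1.
Qed.

End Boundary.

(** * Rates, spectral radius and minimal modulus *)
Section Conclusion.
Variables (R : realType) (H : completeNormedModType R[i]).
Variables (dot : {dot H for conjC}) (hdot : norm_from_dot dot).
Variables (e : int -> H) (he : orthonormal_basis dot e).
Variables (w : int -> R) (S : {linear H -> H}).
Hypothesis hS : bilateral_weighted_shift S e w.

Let b0 n : 0 < beta w n. Proof. by apply: beta_gt0; case: hS. Qed.

Section RightRate.
Variable r : R.
Hypotheses (r0 : 0 <= r)
  (up : forall c, r < c -> upper_growth (growth_right w) c)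
  (lo : forall a, 0 < a < r -> lower_growth (growth_right w) a).

Lemma right_rates :
  [/\ r1_plus w = r, r2_plus w = r, r3_plus w = r & r_plus w = r].
Proof.
have d0 := growth_right_gt0 hS.
have cr := growth_root_cvg d0 r0 up lo.
have T0 : [set: nat] !=set0 by exists 0%N.
split.
- exact: cvg_lim (growth_inf_cvg d0 r0 up lo T0).
- by rewrite /r2_plus cvg_limn_infE; [exact: cvg_lim cr|apply/cvg_ex; exists r].
- by rewrite /r3_plus cvg_limn_supE; [exact: cvg_lim cr|apply/cvg_ex; exists r].
- exact: cvg_lim (growth_sup_cvg d0 r0 up lo T0).
Qed.

End RightRate.

Section LeftRate.
Variable r : R.
Hypotheses (r0 : 0 <= r)
  (up : forall c, r < c -> upper_growth (growth_left w) c)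
  (lo : forall a, 0 < a < r -> lower_growth (growth_left w) a).

Lemma left_rates :
  [/\ r1_minus w = r, r2_minus w = r, r3_minus w = r & r_minus w = r].
Proof.
have d0 := growth_left_gt0 hS.
have cr := growth_root_cvg d0 r0 up lo.
have T0 : [set k : nat | (0 < k)%N] !=set0 by exists 1%N.
have ratioE (n k : nat) : beta w (- k%:Z) / beta w (- n%:Z - k%:Z) =
    growth_left w (n + k) / growth_left w k.
  by rewrite /growth_left invrK mulrC PoszD opprD.
have rootE : (fun n : nat => (1 / beta w (- n%:Z)) `^ n%:R^-1) =
    (fun n : nat => growth_left w n `^ n%:R^-1).
  by apply/funext => n; rewrite div1r.
split.
- rewrite /r1_minus; under eq_fun do under eq_imagel do rewrite ratioE.
  exact: cvg_lim (growth_inf_cvg d0 r0 up lo T0).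
- by rewrite /r2_minus rootE cvg_limn_infE; [exact: cvg_lim cr|apply/cvg_ex; exists r].
- by rewrite /r3_minus rootE cvg_limn_supE; [exact: cvg_lim cr|apply/cvg_ex; exists r].
- rewrite /r_minus; under eq_fun do under eq_imagel do rewrite ratioE.
  exact: cvg_lim (growth_sup_cvg d0 r0 up lo T0).
Qed.

End LeftRate.

Section SpectralBounds.
Variables rl rr : R.
Hypotheses (rl0 : 0 <= rl) (rl_rr : rl <= rr)
  (upl : forall c, rl < c -> upper_growth (growth_left w) c)
  (lol : forall a, 0 < a < rl -> lower_growth (growth_left w) a)
  (upr : forall c, rr < c -> upper_growth (growth_right w) c)
  (lor : forall a, 0 < a < rr -> lower_growth (growth_right w) a).

Let rr0 : 0 <= rr := le_trans rl0 rl_rr.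

Lemma spectrum_le z : spectrum S z -> ComplexField.Normc.normc z <= rr.
Proof.
move=> sz; rewrite leNgt; apply/negP => zr.
pose c := (rr + ComplexField.Normc.normc z) / 2.
have rc : rr < c by rewrite /c; lra.
have cz : c < ComplexField.Normc.normc z by rewrite /c; lra.
have c0 : 0 < c by exact: le_lt_trans rc.
have [C C0 HC] := upper_growth_line b0 c0 (upr rc) (upl (le_lt_trans rl_rr rc)).
exact: (not_spectrum_outside hdot he hS C0 c0 cz HC).
Qed.

Lemma spectrum_ge z : spectrum S z -> rl <= ComplexField.Normc.normc z.
Proof.
move=> sz; rewrite leNgt; apply/negP => zr.
have z0 := normc_ge0 z.
pose c := (rl + ComplexField.Normc.normc z) / 2.
have rc : c < rl by rewrite /c; lra.
have cz : ComplexField.Normc.normc z < c by rewrite /c; lra.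
have c0 : 0 < c by exact: le_lt_trans cz.
have cl : 0 < c < rl by rewrite c0.
have cr : 0 < c < rr by rewrite c0 (lt_le_trans rc).
have cv : 0 < c^-1 by rewrite invr_gt0.
have bv n : 0 < (beta w n)^-1 by rewrite invr_gt0.
have right := upper_growthV (growth_right_gt0 hS) c0 (lor cr).
have left := upper_growthV (growth_left_gt0 hS) c0 (lol cl).
have [C C0 HC] := upper_growth_line bv cv right left.
apply: (not_spectrum_inside hdot he hS (C := C^-1) _ cz _ sz) => [|k n].
  by rewrite invr_gt0.
have := HC k n; rewrite exprVn -[C in X in X -> _]invrK -!invfM.
by rewrite lef_pV2 ?posrE// !mulr_gt0 ?invr_gt0 ?exprn_gt0.
Qed.

Lemma spectral_bounds : min_modulus S = rl /\ spectral_radius S = rr.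
Proof.
have nreal (r : R) : 0 <= r -> ComplexField.Normc.normc r%:C = r.
  by move=> r0; rewrite normc_real ger0_norm.
have srr : spectrum S rr%:C by exact: (right_rate_spectrum hdot he hS).
have srl : spectrum S rl%:C by exact: (left_rate_spectrum hdot he hS).
split; apply/eqP; rewrite eq_le; apply/andP; split.
- apply: ge_inf; first by exists rl => _ [z sz <-]; exact: spectrum_ge.
  by exists rl%:C => //; exact: nreal.
- apply: lb_le_inf; first by exists rl; exists rl%:C => //; exact: nreal.
  by move=> _ [z sz <-]; exact: spectrum_ge.
- apply: ge_sup; first by exists rr; exists rr%:C => //; exact: nreal.
  by move=> _ [z sz <-]; exact: spectrum_le.
- apply: sup_upper_bound; last by exists rr%:C => //; exact: nreal.
  split; first by exists rr; exists rr%:C => //; exact: nreal.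
  by exists rr => _ [z sz <-]; exact: spectrum_le.
Qed.

End SpectralBounds.

End Conclusion.

Theorem theorem4p11 (R : realType) (H : completeNormedModType R[i])
    (dot : {dot H for conjC}) (hdot : norm_from_dot dot)
    (e : int -> H) (he : orthonormal_basis dot e)
    (w : int -> R) (S : {linear H -> H})
    (hS : bilateral_weighted_shift S e w)
    (hbeta : bishop_property_beta S) :
  [/\ min_modulus S = r1_minus w,
      r1_minus w = r2_minus w,
      r2_minus w = r3_minus w &
      r3_minus w = r_minus w] /\
  [/\ r1_plus w = r2_plus w,
      r2_plus w = r3_plus w,
      r3_plus w = r_plus w &
      r_plus w = spectral_radius S].
Proof.
have [M M0 [uMr uMl]] := weight_growth_bounded hS.
have [|rr rr0 [upr lor]] :=
  growth_threshold (growth_right_gt0 hS) (ex_intro2 _ _ M M0 uMr).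
  exact: (growth_right_dichotomy hdot he hS hbeta).
have [|rl rl0 [upl lol]] :=
  growth_threshold (growth_left_gt0 hS) (ex_intro2 _ _ M M0 uMl).
  exact: (growth_left_dichotomy hdot he hS hbeta).
have rl_rr := growth_left_le_right hdot he hS hbeta rr0 upr lol.
have [-> -> -> ->] := left_rates hS rl0 upl lol.
have [-> -> -> ->] := right_rates hS rr0 upr lor.
by have [-> ->] := spectral_bounds hdot he hS rl0 rl_rr upl lol upr lor.
Qed.
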